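(* Let $(M,g)$ be a Riemannian manifold and let $T^1_1(M)$ be its $(1,1)$-tensor bundle equipped with the rescaled Sasaki type metric ${}^Sg_f$ and the almost product structure $J$ given by $J({}^HX)=-{}^HX$, $J({}^VA)={}^VA$. Let $\widetilde\nabla$ be the Levi-Civita connection of ${}^Sg_f$ and let ${}^{(P)}\widetilde\nabla_{\widetilde X}\widetilde Y=\widetilde\nabla_{\widetilde X}\widetilde Y-\widetilde S(\widetilde X,\widetilde Y)$, where $$\widetilde S(\widetilde X,\widetilde Y)=\tfrac12\{(\widetilde\nabla_{J\widetilde Y}J)\widetilde X+J((\widetilde\nabla_{\widetilde Y}J)\widetilde X)-J((\widetilde\nabla_{\widetilde X}J)\widetilde Y)\}.$$ Then, for all vector fields $X,Y$ and $(1,1)$-tensor fields $B,C$ on $M$, $$\begin{aligned} i)\ &{}^{(P)}\widetilde\nabla_{{}^HX}{}^HY={}^H\big(\nabla_XY+\tfrac1{2f}{}^fA(X,Y)\big),\\ ii)\ &{}^{(P)}\widetilde\nabla_{{}^HX}{}^VB={}^V(\nabla_XB),\\ iii)\ &{}^{(P)}\widetilde\nabla_{{}^VC}{}^HY=\tfrac3{2f}\,{}^H\big(g^{bl}R(t_b,C_l)Y+g_{ac}\,t^a(g^{-1}\circ R(\ \cdot\ ,Y)\widetilde C^{\,c})\big),\\ iv)\ &{}^{(P)}\widetilde\nabla_{{}^VC}{}^VB=0 . \end{aligned}$$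
   Context: All objects are smooth; Einstein summation. $f>0$ is a smooth function on $M$ (also viewed on the bundle by pullback). $\nabla$ is the Levi-Civita connection of $g$ with Christoffel symbols $\Gamma_{ij}^h$; $R(X,Y)=[\nabla_X,\nabla_Y]-\nabla_{[X,Y]}$, $R(\partial_k,\partial_l)\partial_j=R_{klj}{}^s\partial_s$. $T^1_1(M)$ is the bundle of $(1,1)$-tensors, with induced local coordinates $(x^j,t_j^i)$, a point being $t=t_j^i\,\partial_i\otimes dx^j$ at $x$. The vertical lift of a $(1,1)$-tensor field $A$ is ${}^VA=A_j^i\,\partial/\partial t_j^i$; the horizontal lift of a vector field $X$ is ${}^HX=X^j\partial/\partial x^j+X^s(\Gamma_{sj}^mt_m^i-\Gamma_{sm}^it_j^m)\,\partial/\partial t_j^i$; the same formula lifts a vector of $T_xM$ to a horizontal vector at a point $t$ over $x$, also when the vector depends on $t$. The metric is ${}^Sg_f({}^VA,{}^VB)=g_{ic}g^{jl}A_j^iB_l^c$, ${}^Sg_f({}^VA,{}^HY)=0$, ${}^Sg_f({}^HX,{}^HY)=f\,g(X,Y)$. ${}^fA(X,Y)=X(f)Y+Y(f)X-g(X,Y)\,\mathrm{grad}_g f$. Notation in iii), at the point $t$: $t_b=t_b^s\partial_s$ and $C_l=C_l^i\partial_i$ are vectors, so $g^{bl}R(t_b,C_l)Y$ has components $g^{bl}t_b^sC_l^iR_{sim}{}^rY^m$; $t^a=t_s^a\,dx^s$ is a covector, $\widetilde C^{\,c}=g^{bl}C_l^c\,\partial_b$ is a vector, and $g_{ac}\,t^a(g^{-1}\circ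 R(\cdot,Y)\widetilde C^{\,c})$ is the vector with components $g_{ac}\,t_s^a\,g^{kr}R_{kmb}{}^sY^m g^{bl}C_l^c$ (index $r$). *)

(* Defs.v *)
(* Smooth manifolds are presented by charts, and tensor fields and affine
   connections classically: by their components in every chart, subject to
   smoothness and to the transformation law on overlaps.  A field is a function
   of the chart and of the point; its value at [a], [p] is meaningful only when
   [p] lies in the domain of the chart [a]. *)
From HB Require Import structures.
From mathcomp Require Import all_boot all_order all_algebra.
From mathcomp Require Import all_classical all_reals all_analysis.

Set Implicit Arguments.
Unset Strict Implicit.
Unset Printing Implicit Defensive.

Import Order.TTheory GRing.Theory Num.Theory.
Import numFieldNormedType.Exports.

Local Open Scope classical_set_scope.
Local Open Scope ring_scope.

Record charts (R : realType) (T : Type) (m : nat) := Charts {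
  cidx : Type;
  cdom : cidx -> set T;
  ccoord : cidx -> T -> 'rV[R]_m }.

Section Calculus.
Context {R : realType} {T : Type} {m : nat} (N : charts R T m).
Implicit Types (a b : cidx N) (p q : T).

(* F o x_a^-1, where x_a is the chart map of a; 0 outside of the image of x_a. *)
Definition local_rep a (F : T -> R) (x : 'rV[R]_m) : R :=
  xget 0 [set v | exists2 p, cdom a p & ccoord a p = x /\ v = F p].

(* dF/dx^i in the chart a. *)
Definition pd a (i : 'I_m) (F : T -> R) (p : T) : R :=
  'D_(delta_mx 0 i) (local_rep a F) (ccoord a p).

(* C^infty: all iterated partial derivatives are differentiable. *)
Definition smooth_on a (D : set T) (F : T -> R) : Prop :=
  forall (s : seq 'I_m) (p : T), D p ->
    differentiable (local_rep a (foldr (pd a) F s)) (ccoord a p).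

(* dx_b^i / dx_a^j. *)
Definition jac a b p : 'M[R]_m :=
  \matrix_(i, j) pd a j (fun q => ccoord b q 0 i) p.

Definition smooth_fun (F : T -> R) : Prop := forall a, smooth_on a (cdom a) F.

End Calculus.

Record smooth_manifold (R : realType) (T : topologicalType) (m : nat)
    (N : charts R T m) : Prop := SmoothManifold {
  man_hausdorff : hausdorff_space T;
  man_second_countable : @second_countable T;
  man_cover : forall p, exists a : cidx N, cdom a p;
  man_dom_open : forall a : cidx N, open (cdom a);
  man_coord_inj : forall (a : cidx N) p q, cdom a p -> cdom a q ->
    ccoord a p = ccoord a q -> p = q;
  (* the chart map is a homeomorphism of its domain onto an open set *)
  man_coord_homeo : forall (a : cidx N) (D : set T), D `<=` cdom a ->
    (open D <-> open (ccoord a @` D));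
  man_transition : forall (a b : cidx N) (i : 'I_m),
    smooth_on a (cdom a `&` cdom b) (fun p => ccoord b p 0 i) }.

Section Fields.
Context {R : realType} {T : Type} {m : nat} (N : charts R T m).
Implicit Types (a b : cidx N) (p q : T).

Definition vfamily := cidx N -> T -> 'rV[R]_m.
Definition mfamily := cidx N -> T -> 'M[R]_m.

Definition same_family (X Y : vfamily) : Prop :=
  forall a p, cdom a p -> X a p = Y a p.

Record vector_field := VectorField {
  vcomp :> cidx N -> T -> 'rV[R]_m;
  vcomp_smooth : forall a i, smooth_on a (cdom a) (fun p => vcomp a p 0 i);
  vcomp_change : forall a b p, cdom a p -> cdom b p -> forall i,
    vcomp b p 0 i = \sum_j jac a b p i j * vcomp a p 0 j }.

(* (1,1)-tensor fields: the entry (i, j) is A_j^i, with row index i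
   contravariant and column index j covariant. *)
Record tensor11_field := Tensor11Field {
  tcomp :> cidx N -> T -> 'M[R]_m;
  tcomp_smooth : forall a i j, smooth_on a (cdom a) (fun p => tcomp a p i j);
  tcomp_change : forall a b p, cdom a p -> cdom b p -> forall i j,
    tcomp b p i j =
    \sum_h \sum_k jac a b p i h * jac b a p k j * tcomp a p h k }.

Definition bilin (G : 'M[R]_m) (v w : 'rV[R]_m) : R :=
  \sum_i \sum_j G i j * v 0 i * w 0 j.

Record metric := Metric {
  gcomp :> cidx N -> T -> 'M[R]_m;
  gcomp_smooth : forall a i j, smooth_on a (cdom a) (fun p => gcomp a p i j);
  gcomp_change : forall a b p, cdom a p -> cdom b p -> forall i j,
    gcomp b p i j =
    \sum_h \sum_k jac b a p h i * jac b a p k j * gcomp a p h k;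
  gcomp_sym : forall a p, cdom a p -> forall i j, gcomp a p i j = gcomp a p j i;
  gcomp_posdef : forall a p, cdom a p -> forall v : 'rV[R]_m, v != 0 ->
    0 < bilin (gcomp a p) v v }.

(* Affine connections: [con a p h i j] is Gamma_{ij}^h, i.e.
   nabla_{d_i} d_j = Gamma_{ij}^h d_h. *)
Record connection := Connection {
  con :> cidx N -> T -> 'I_m -> 'I_m -> 'I_m -> R;
  con_smooth : forall a h i j, smooth_on a (cdom a) (fun p => con a p h i j);
  con_change : forall a b p, cdom a p -> cdom b p -> forall k i j,
    \sum_h jac a b p k h * con a p h i j =
    pd a i (fun q => jac a b q k j) p
    + \sum_c \sum_d con b p k c d * jac a b p c i * jac a b p d j }.

(* Zero torsion and nabla g = 0. *)
Definition levi_civita (g : metric) (D : connection) : Prop :=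
  (forall a p, cdom a p -> forall h i j, D a p h i j = D a p h j i) /\
  (forall a p, cdom a p -> forall k i j,
    pd a k (fun q => g a q i j) p
    = \sum_l (D a p l k i * g a p l j + D a p l k j * g a p i l)).

Definition ginv (g : metric) a p : 'M[R]_m := invmx (g a p).

Definition dirder (X : vfamily) (F : T -> R) a p : R :=
  \sum_i X a p 0 i * pd a i F p.

Definition grad (g : metric) (F : T -> R) : vfamily := fun a p =>
  \row_h \sum_k ginv g a p h k * pd a k F p.

Definition bracket (X Y : vfamily) : vfamily := fun a p =>
  \row_h (dirder X (fun q => Y a q 0 h) a p - dirder Y (fun q => X a q 0 h) a p).

Definition nabla (D : connection) (X Y : vfamily) : vfamily := fun a p =>
  \row_h (dirder X (fun q => Y a q 0 h) a p
          + \sum_i \sum_j D a p h i j * X a p 0 i * Y a p 0 j).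

Definition nabla11 (D : connection) (X : vfamily) (B : mfamily) : mfamily :=
  fun a p => \matrix_(i, j)
    (dirder X (fun q => B a q i j) a p
     + \sum_s X a p 0 s *
         \sum_k (D a p i s k * B a p k j - D a p k s j * B a p i k)).

(* R(X,Y)Z = [nabla_X, nabla_Y] Z - nabla_[X,Y] Z. *)
Definition curvature (D : connection) (X Y Z : vfamily) : vfamily := fun a p =>
  nabla D X (nabla D Y Z) a p - nabla D Y (nabla D X Z) a p
  - nabla D (bracket X Y) Z a p.

(* The coordinate field d_k of each chart (a local frame, not a global field). *)
Definition coord_field (k : 'I_m) : vfamily := fun _ _ => delta_mx 0 k.

(* R_{klj}^s, where R(d_k, d_l) d_j = R_{klj}^s d_s. *)
Definition Rcomp (D : connection) a p (k l j s : 'I_m) : R :=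
  curvature D (coord_field k) (coord_field l) (coord_field j) a p 0 s.

Definition app11 (A : 'M[R]_m) (v : 'rV[R]_m) : 'rV[R]_m :=
  \row_i \sum_j A i j * v 0 j.

Definition appf (J : tensor11_field) (X : vfamily) : vfamily :=
  fun a p => app11 (J a p) (X a p).

(* (nabla_X J) Y *)
Definition nablaJ (D : connection) (J : tensor11_field) (X Y : vfamily)
    : vfamily :=
  fun a p => nabla D X (appf J Y) a p - appf J (nabla D X Y) a p.

Definition Stensor (D : connection) (J : tensor11_field) (X Y : vfamily)
    : vfamily := fun a p =>
  2^-1 *: (nablaJ D J (appf J Y) X a p
           + appf J (nablaJ D J Y X) a p
           - appf J (nablaJ D J X Y) a p).

Definition nablaP (D : connection) (J : tensor11_field) (X Y : vfamily)
    : vfamily := fun a p => nabla D X Y a p - Stensor D J X Y a p.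

(* X(f) Y + Y(f) X - g(X,Y) grad f *)
Definition fA (g : metric) (f : T -> R) (X Y : vfamily) : vfamily := fun a p =>
  dirder X f a p *: Y a p + dirder Y f a p *: X a p
  - bilin (g a p) (X a p) (Y a p) *: grad g f a p.

End Fields.

Section TensorBundle.
Context {R : realType} {T : Type} {n : nat} (M : charts R T n).

(* A point of T^1_1(M): a base point together with the components t_j^i, in all
   the charts around it, of a (1,1)-tensor there.  [tens_out] merely normalizes
   the irrelevant values in the other charts. *)
Record T11 := T11Point {
  base : T;
  tens : cidx M -> 'M[R]_n;
  tens_change : forall a b, cdom a base -> cdom b base -> forall i j,
    tens b i j =
    \sum_h \sum_k jac a b base i h * jac b a base k j * tens a h k;
  tens_out : forall a, ~ cdom a base -> tens a = 0 }.

(* The charts of T^1_1(M) induced by those of M: coordinates (x^j, t_j^i). *)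
Definition T11_charts : charts R T11 (n + n * n) :=
  @Charts R T11 (n + n * n) (cidx M)
    (fun a => [set t | cdom a (base t)])
    (fun a t => row_mx (ccoord a (base t)) (mxvec (tens t a))).

(* Lifts to the point t, in the induced coordinates. *)
Definition vlift_at (A : 'M[R]_n) : 'rV[R]_(n + n * n) := row_mx 0 (mxvec A).

Definition hlift_at (D : connection M) (a : cidx M) (t : T11) (X : 'rV[R]_n)
    : 'rV[R]_(n + n * n) :=
  row_mx X (mxvec (\matrix_(i, j) \sum_s X 0 s *
    \sum_m (D a (base t) m s j * tens t a i m
            - D a (base t) i s m * tens t a m j))).

Definition vlift (A : mfamily M) : vfamily T11_charts :=
  fun a t => vlift_at (A a (base t)).

Definition hlift (D : connection M) (X : vfamily M) : vfamily T11_charts :=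
  fun a t => hlift_at D a t (X a (base t)).

(* The defining equations of the rescaled Sasaki type metric, for all tensors
   A, B and vectors X, Y at the base point of t; every such tensor or vector is
   the value there of a global field, so this is the same as asking for them on
   lifts of fields. *)
Definition rescaled_sasaki (g : metric M) (D : connection M) (f : T -> R)
    (S : metric T11_charts) : Prop :=
  forall (a : cidx M) (t : T11), cdom a (base t) ->
  forall (A B : 'M[R]_n) (X Y : 'rV[R]_n),
  [/\ bilin (S a t) (vlift_at A) (vlift_at B) =
        \sum_i \sum_c \sum_j \sum_l
          g a (base t) i c * ginv g a (base t) j l * A i j * B c l,
      bilin (S a t) (vlift_at A) (hlift_at D a t Y) = 0 &
      bilin (S a t) (hlift_at D a t X) (hlift_at D a t Y) =
        f (base t) * bilin (g a (base t)) X Y].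

(* J(^HX) = - ^HX and J(^VA) = ^VA. *)
Definition product_structure (D : connection M) (J : tensor11_field T11_charts)
    : Prop :=
  forall (a : cidx M) (t : T11), cdom a (base t) ->
  forall (A : 'M[R]_n) (X : 'rV[R]_n),
    app11 (J a t) (hlift_at D a t X) = - hlift_at D a t X /\
    app11 (J a t) (vlift_at A) = vlift_at A.

(* g^{bl} R(t_b, C_l) Y, a vector at the base point of t. *)
Definition curv_term1 (g : metric M) (D : connection M) (C : mfamily M)
    (Y : vfamily M) (a : cidx M) (t : T11) : 'rV[R]_n :=
  let p := base t in
  \row_r \sum_b \sum_l \sum_s \sum_i \sum_m
    ginv g a p b l * tens t a s b * C a p i l * Rcomp D a p s i m r
    * Y a p 0 m.

(* g_{ac} t^a (g^-1 o R( . , Y) C~^c), a vector at the base point of t; the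
   index a of the formula is called e here. *)
Definition curv_term2 (g : metric M) (D : connection M) (C : mfamily M)
    (Y : vfamily M) (a : cidx M) (t : T11) : 'rV[R]_n :=
  let p := base t in
  \row_r \sum_e \sum_c \sum_s \sum_k \sum_m \sum_b \sum_l
    g a p e c * tens t a e s * ginv g a p k r * Rcomp D a p k m b s
    * Y a p 0 m * ginv g a p b l * C a p c l.

End TensorBundle.

(* Main.v *)
Require Import Defs.
From HB Require Import structures.
From mathcomp Require Import all_boot all_order all_algebra.
From mathcomp Require Import all_classical all_reals all_analysis.
From mathcomp Require Import ring lra.

Set Implicit Arguments.
Unset Strict Implicit.
Unset Printing Implicit Defensive.

Import Order.TTheory GRing.Theory Num.Theory.
Import numFieldNormedType.Exports.

Local Open Scope classical_set_scope.
Local Open Scope ring_scope.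

(** Let J be the product structure and nabla~ the Levi-Civita connection of the
    rescaled Sasaki type metric.  Lifts are eigenvectors of J with eigenvalues
    -1 and 1, and J is an involution; hence S~(X, Y), for lifts X and Y, is a
    combination of nabla~_X Y, nabla~_Y X and of their images by J
    ([nablaP_eigen]).  In case i) subtracting it leaves the horizontal part of
    nabla~_X Y, in case ii) the vertical part, in case iv) nothing, since there
    both derivatives vanish.  In case iii) it leaves nabla~_{VC} HY plus twice
    the horizontal part of nabla~_{HY} VC; as the bracket of HY and VC is
    vertical, both are the same vector, which explains the factor 3.

    It remains to find nabla~ on lifts, in one induced chart and at one point
    t.  Fields are first replaced by fields with constant components
    ([nabla_hlift_const], [nabla_vlift_const]): what this loses is the
    derivative of the components, which gives nabla_X Y and nabla_X B together
    with the Christoffel terms.  For the frame of constant lifts, the Koszul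
    formula ([koszul]) needs the brackets
        [Hx, Hy] = V(t Om(x, y) - Om(x, y) t),  [Hx, VA] = V(w(x) A - A w(x)),
    where w is the matrix of connection forms and Om that of curvature forms,
    and the derivatives of the metric, which are those of f g and of the metric
    induced by g on (1,1)-tensors, because vertical vectors kill functions of
    the base point.  It yields [nabla_VV], [nabla_VH], [nabla_HV], [nabla_HH].

    In [nabla_VH] the horizontal vector k = nabla~_{VC} HY appears as
        2 f g(k, x) = < t Om(x, Y) - Om(x, Y) t, C >  for all x.
    The term t Om is the second curvature term of the theorem, by definition of
    the contractions.  The term Om t is the first one, by the symmetry by pairs
    g(R(x, Y)u, c) = g(R(u, c)x, Y) of the curvature tensor ([riem_pair]).
    This symmetry rests on the first Bianchi identity and on the antisymmetry
    of g R(x, y), that is, on the equality of mixed derivatives of the metric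
    coefficients ([derive_comm]). *)

(** * Mixed directional derivatives *)
Section Schwarz.
Context {R : realType} {V : normedModType R}.
Implicit Types (f : V -> R) (a u v w : V).

Lemma diff_remainder f a (e : R) : differentiable f a -> 0 < e ->
  \forall w \near (0 : V), `|f (w + a) - f a - 'd f a w| <= e * `|w|.
Proof.
move=> df e0.
have /diff_locallyP[_ /eqaddoP /(_ _ e0)] := df.
by apply: filterS => w /=; rewrite !fctE/= opprD addrA.
Qed.

Definition second_difference f a u v (h : R) : R :=
  f (h *: u + h *: v + a) - f (h *: u + a) - f (h *: v + a) + f a.

Lemma second_differenceC f a u v h :
  second_difference f a u v h = second_difference f a v u h.
Proof. by rewrite /second_difference [h *: u + h *: v]addrC [_ - _ - _]addrAC. Qed.

Lemma is_derive_along f a u (s : R) : differentiable f (s *: u + a) ->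
  is_derive s (1 : R) (fun s => f (s *: u + a)) ('D_u f (s *: u + a)).
Proof.
move=> /(@diff_derivable _ _ _ _ _ u).
have E : (fun h : R => h^-1 *: (((fun s => f (s *: u + a)) \o shift s) (h *: 1)
            - f (s *: u + a)))
       = (fun h => h^-1 *: ((f \o shift (s *: u + a)) (h *: u)
            - f (s *: u + a))).
  by apply/funext => h /=; rewrite [h *: 1]mulr1 scalerDl addrA.
by move=> du; split; rewrite /derivable /derive E.
Qed.

(** The mean value theorem in the direction [u] makes the second difference [h]
    times a difference of two values of the derivative along [u]; the
    differential of that derivative at [a] evaluates it up to o(h). *)
Lemma second_difference_bound f a u v (e : R) :
  (\forall x \near a, differentiable f x) ->
  differentiable ('D_u f) a -> 0 < e ->
  \forall h \near (0 : R)^'+,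
    `|second_difference f a u v h - h ^+ 2 * 'D_v ('D_u f) a|
      <= e * h ^+ 2 * (2 * `|u| + `|v|).
Proof.
move=> nf dDf e0.
(* On the ball of radius [r] the error of the linear approximation is under
   control; the parallelogram of sides [h *: u] and [h *: v] fits into it. *)
have [r /= r0 Hr] : exists2 r : R, 0 < r & forall w, `|w| < r ->
    differentiable f (w + a) /\
    `|'D_u f (w + a) - 'D_u f a - 'd ('D_u f) a w| <= e * `|w|.
  have : \forall w \near (0 : V), differentiable f (w + a) /\
    `|'D_u f (w + a) - 'D_u f a - 'd ('D_u f) a w| <= e * `|w|.
    near=> w; split; last by near: w; exact: diff_remainder.
    near: w; move: nf; rewrite (near_shift 0) /=.
    by apply: filterS => x /=; rewrite subr0.
  move=> /nbhs_normP[r /= r0 H]; exists r => // w wr; apply: H => /=.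
  by rewrite /ball_ /= sub0r normrN.
near=> h.
have h0 : 0 < h by near: h; exact: nbhs_right_gt.
have Kp : 0 < 1 + `|u| + `|v| by rewrite -addrA ltr_pwDl// addr_ge0.
have hr : h * (1 + `|u| + `|v|) < r.
  rewrite -ltr_pdivlMr//; near: h; apply: nbhs_right_lt; exact: divr_gt0.
have small s t : 0 <= s <= h -> 0 <= t <= h -> `|s *: u + t *: v| < r.
  move=> /andP[s0 sh] /andP[t0 th].
  apply: le_lt_trans hr; apply: le_trans (ler_normD _ _) _.
  rewrite !normrZ !ger0_norm// -addrA !mulrDr ler_wpDl ?mulr1 ?(ltW h0)//.
  by rewrite lerD// ler_wpM2r.
pose phi (s : R) := f (s *: u + (h *: v + a)) - f (s *: u + a).
pose dphi (s : R) := 'D_u f (s *: u + (h *: v + a)) - 'D_u f (s *: u + a).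
have hh : 0 <= h <= h by rewrite lexx ltW.
have h00 : 0 <= (0 : R) <= h by rewrite lexx ltW.
have dd (s : R) : 0 <= s <= h -> is_derive s (1 : R) phi (dphi s).
  move=> sh; apply: is_deriveB; apply: is_derive_along.
    by rewrite addrA; have [] := Hr _ (small _ _ sh hh).
  have [] := Hr (s *: u) => //.
  by have := small _ _ sh h00; rewrite scale0r addr0.
have [c cI] : exists2 c, c \in `]0, h[%R & phi h - phi 0 = dphi c * (h - 0).
  apply: MVT => //.
    by move=> s; rewrite in_itv/= => /andP[s0 sh]; apply: dd; rewrite !ltW.
  apply: derivable_within_continuous => s; rewrite in_itv/= => sh.
  by have [] := dd _ sh.
have ch : 0 <= c <= h by move: cI; rewrite in_itv/= => /andP[*]; rewrite !ltW.
rewrite subr0 => E.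
have -> : second_difference f a u v h = dphi c * h.
  rewrite -E /phi /second_difference !scale0r !add0r addrA.
  by rewrite opprB addrA; lra.
have [_ H1] := Hr _ (small _ _ ch hh).
have [_ H2] := Hr _ (small _ _ ch h00).
move: H2; rewrite scale0r addr0 => H2.
have cu : `|c *: u| <= h * `|u|.
  have /andP[c0 c1] := ch.
  by rewrite normrZ ger0_norm// ler_wpM2r.
have cv : `|c *: u + h *: v| <= h * `|u| + h * `|v|.
  by apply: le_trans (ler_normD _ _) _; rewrite lerD// normrZ gtr0_norm.
have -> : dphi c * h - h ^+ 2 * 'D_v ('D_u f) a =
  (('D_u f (c *: u + h *: v + a) - 'D_u f a - 'd ('D_u f) a (c *: u + h *: v))
   - ('D_u f (c *: u + a) - 'D_u f a - 'd ('D_u f) a (c *: u))) * h.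
  have -> : 'D_v ('D_u f) a = 'd ('D_u f) a v by exact: deriveE.
  have -> : 'd ('D_u f) a (c *: u + h *: v) =
      'd ('D_u f) a (c *: u) + h * 'd ('D_u f) a v.
    by rewrite [LHS]linearD; congr (_ + _); rewrite [LHS]linearZ.
  by rewrite /dphi addrA; ring.
rewrite normrM (gtr0_norm h0).
have -> : e * h ^+ 2 * (2 * `|u| + `|v|) =
  (e * (h * `|u| + h * `|v|) + e * (h * `|u|)) * h by ring.
rewrite ler_wpM2r ?(ltW h0)//.
apply: le_trans (ler_normB _ _) _; apply: lerD.
  by apply: le_trans H1 _; rewrite ler_pM2l.
by apply: le_trans H2 _; rewrite ler_pM2l.
Unshelve. all: by end_near. Qed.

(** The second difference is symmetric in [u] and [v], and divided by the square
    of [h] it tends to both iterated derivatives. *)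
Lemma derive_comm f a u v :
  (\forall x \near a, differentiable f x) ->
  differentiable ('D_u f) a -> differentiable ('D_v f) a ->
  'D_u ('D_v f) a = 'D_v ('D_u f) a.
Proof.
move=> nf du dv; apply/eqP; rewrite -subr_eq0 -normr_le0.
pose K := (2 * `|u| + `|v|) + (2 * `|v| + `|u|) + 1.
have K0 : 0 < K by rewrite /K ltr_wpDl// !addr_ge0// mulr_ge0.
apply/ler_addgt0Pl => e e0; rewrite addr0.
have eK : 0 < e / K by rewrite divr_gt0.
have : \forall h \near (0 : R)^'+, `|'D_u ('D_v f) a - 'D_v ('D_u f) a| <= e.
  near=> h.
  have h0 : 0 < h by near: h; exact: nbhs_right_gt.
  have h2 : 0 < h ^+ 2 by rewrite exprn_gt0.
  have H1 : `|second_difference f a u v h - h ^+ 2 * 'D_v ('D_u f) a|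
      <= e / K * h ^+ 2 * (2 * `|u| + `|v|).
    by near: h; exact: second_difference_bound.
  have H2 : `|second_difference f a u v h - h ^+ 2 * 'D_u ('D_v f) a|
      <= e / K * h ^+ 2 * (2 * `|v| + `|u|).
    rewrite second_differenceC.
    by near: h; exact: second_difference_bound.
  rewrite -(ler_pM2l h2) -{1}(gtr0_norm h2) -normrM.
  have E (k A B C : R) : k * (C - B) = (A - k * B) - (A - k * C) by ring.
  rewrite (E _ (second_difference f a u v h)).
  apply: le_trans (ler_normB _ _) _; apply: le_trans (lerD H1 H2) _.
  have -> : h ^+ 2 * e = e / K * h ^+ 2 * K by field; rewrite gt_eqF.
  rewrite -mulrDr (ler_pM2l (mulr_gt0 eK h2)).
  by rewrite /K lerDl.
by move=> /filter_ex[].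
Unshelve. all: by end_near. Qed.

End Schwarz.

(** * Calculus in a chart *)
Lemma near_eq_differentiable (R : numFieldType) (V W : normedModType R)
    (f g : V -> W) (a : V) :
  {near a, f =1 g} -> differentiable f a -> differentiable g a.
Proof.
move=> fg /diff_locallyP[dc E].
have E' : g \o shift a = cst (g a) + 'd f a +o_ 0 id.
  apply/eqaddoP => e e0; move/eqaddoP : E => /(_ _ e0).
  have fg0 : \forall w \near (0 : V), f (w + a) = g (w + a).
    move: fg; rewrite (near_shift 0) /=.
    by apply: filterS => x /=; rewrite subr0.
  apply: filterS2 fg0 => w /=; rewrite !fctE/= => -> .
  by rewrite (nbhs_singleton fg).
by apply/diff_locallyP; rewrite (diff_unique dc E').
Qed.

Section ChartCalculus.
Context {R : realType} {T : Type} {m : nat} {N : charts R T m}.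
Implicit Types (a : cidx N) (p q : T) (F G : T -> R).

(** Partial derivatives are derivatives of [local_rep], which is 0 outside of the
    image of the chart: they mean something when this image is a neighbourhood
    of each of its points. *)
Definition proper_chart a : Prop :=
  {in cdom a &, injective (ccoord a)} /\
  forall p, cdom a p -> \forall x \near ccoord a p, (ccoord a @` cdom a) x.

Lemma local_rep_at a p F : {in cdom a &, injective (ccoord a)} ->
  cdom a p -> local_rep a F (ccoord a p) = F p.
Proof.
move=> inj ap; apply: xget_unique; first by exists p.
by move=> _ [q aq [qp ->]]; congr F; apply: inj; rewrite ?inE.
Qed.

Lemma local_rep_out a F x : ~ (ccoord a @` cdom a) x -> local_rep a F x = 0.
Proof. by move=> nx; apply: xgetPN => y [q aq [qx _]]; apply: nx; exists q. Qed.

Lemma eq_local_rep a F G : (forall p, cdom a p -> F p = G p) ->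
  local_rep a F = local_rep a G.
Proof.
move=> FG; apply/funext => x; rewrite /local_rep; congr (xget 0 _).
by apply/seteqP; split=> _ [q aq [qx ->]]; exists q; rewrite ?FG.
Qed.

Lemma pd_ext a i F G p : (forall q, cdom a q -> F q = G q) ->
  pd a i F p = pd a i G p.
Proof. by move=> FG; rewrite /pd (eq_local_rep FG). Qed.

Definition diffable a F p := differentiable (local_rep a F) (ccoord a p).

Lemma diffable_ext a F G p : (forall q, cdom a q -> F q = G q) ->
  diffable a F p -> diffable a G p.
Proof. by move=> FG; rewrite /diffable (eq_local_rep FG). Qed.

(** Contrary to [dirder], the direction is a vector and not a field, so that
    linearity in it can be stated. *)
Definition dirv a (v : 'rV[R]_m) F p : R := \sum_i v 0 i * pd a i F p.

Lemma dirv_ext a v F G p : (forall q, cdom a q -> F q = G q) ->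
  dirv a v F p = dirv a v G p.
Proof. by move=> FG; apply: eq_bigr => i _; rewrite (pd_ext _ _ FG). Qed.

Lemma dirvE a v F p : diffable a F p ->
  dirv a v F p = 'D_v (local_rep a F) (ccoord a p).
Proof.
move=> dF; rewrite deriveE// [X in 'd _ _ X]row_sum_delta linear_sum/=.
by apply: eq_bigr => i _; rewrite linearZ/= /pd deriveE.
Qed.

Lemma dirv_linear a F p c v w :
  dirv a (c *: v + w) F p = c * dirv a v F p + dirv a w F p.
Proof.
rewrite /dirv mulr_sumr -big_split/=; apply: eq_bigr => i _.
by rewrite !mxE mulrDl mulrA.
Qed.

Lemma dirv0 a F p : dirv a 0 F p = 0.
Proof. by rewrite /dirv big1// => i _; rewrite mxE mul0r. Qed.

(** A diagonal coefficient of the metric is positive at [p] and its local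
    representation is continuous there, hence nonzero nearby, whereas local
    representations vanish outside of the image of the chart.  This applies to
    the manifold and to its tensor bundle alike. *)
Lemma metric_proper_chart (S : metric N) a :
  {in cdom a &, injective (ccoord a)} -> proper_chart a.
Proof.
move=> inj; split=> // p ap.
(* In dimension 0 there is only one coordinate vector. *)
have [i0|[i0]] : ('I_m -> False) \/ exists i : 'I_m, True.
  have [[i]|ni] := pselect (exists i : 'I_m, True); first by right; exists i.
  by left=> i; apply: ni; exists i.
  by apply: filterE => x; exists p => //; apply/rowP => i; case: (i0 i).
move=> _.
pose F q := S a q i0 i0.
have Fp : 0 < F p.
  have := @gcomp_posdef _ _ _ _ S a p ap (delta_mx 0 i0) _.
  rewrite /bilin (bigD1 i0)//= [X in _ + X]big1 ?addr0; last first.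
    by move=> i ii0; rewrite big1// => j _; rewrite !mxE (negbTE ii0)/= mulr0 mul0r.
  rewrite (bigD1 i0)//= [X in _ + X]big1 ?addr0; last first.
    by move=> j ji0; rewrite !mxE (negbTE ji0)/= mulr0.
  rewrite !mxE !eqxx !mulr1; apply.
  by apply/eqP => /rowP/(_ i0); rewrite !mxE !eqxx; apply/eqP/oner_neq0.
have /differentiable_continuous cF : diffable a F p.
  exact: (@gcomp_smooth _ _ _ _ S a i0 i0 [::]).
have : \forall x \near ccoord a p, local_rep a F x != 0.
  by apply: (cvgr_neq0 (local_rep a F (ccoord a p)) cF); rewrite local_rep_at// gt_eqF.
apply: filterS => x /eqP Fx; apply: contrapT => nx.
by apply: Fx; rewrite local_rep_out.
Qed.

Lemma near_local_rep a p : proper_chart a -> cdom a p ->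
  \forall x \near ccoord a p, exists2 q, cdom a q & ccoord a q = x /\
    forall F, local_rep a F x = F q.
Proof.
move=> [inj nb] ap; apply: filterS (nb _ ap) => _ [q aq <-].
by exists q => //; split=> // F; rewrite local_rep_at.
Qed.

Section At.
Context (a : cidx N) (p : T) (pa : proper_chart a) (ap : cdom a p).
Let inj := pa.1.

(** Local representations add and multiply on the whole coordinate space, not only
    near a point, since they vanish outside of the image of the chart. *)
Lemma local_repD F G :
  local_rep a (fun q => F q + G q) = local_rep a F + local_rep a G.
Proof.
apply/funext => x; rewrite fctE.
have [[q aq <-]|nx] := pselect ((ccoord a @` cdom a) x).
  by rewrite !local_rep_at.
by rewrite !local_rep_out// addr0.
Qed.

Lemma local_repN F : local_rep a (fun q => - F q) = - local_rep a F.
Proof.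
apply/funext => x; rewrite fctE.
have [[q aq <-]|nx] := pselect ((ccoord a @` cdom a) x).
  by rewrite !local_rep_at.
by rewrite !local_rep_out// oppr0.
Qed.

Lemma local_repM F G :
  local_rep a (fun q => F q * G q) = local_rep a F * local_rep a G.
Proof.
apply/funext => x; rewrite fctE.
have [[q aq <-]|nx] := pselect ((ccoord a @` cdom a) x).
  by rewrite !local_rep_at.
by rewrite !local_rep_out// mulr0.
Qed.

Lemma local_repV F :
  local_rep a (fun q => (F q)^-1) = (fun x => (local_rep a F x)^-1).
Proof.
apply/funext => x; have [[q aq <-]|nx] := pselect ((ccoord a @` cdom a) x).
  by rewrite !local_rep_at.
by rewrite !local_rep_out// invr0.
Qed.

Lemma near_local_rep_cst c :
  {near ccoord a p, cst c =1 local_rep a (fun=> c)}.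
Proof. by apply: filterS (near_local_rep pa ap) => x [q aq [_ ->]]. Qed.

Lemma diffable_cst c : diffable a (fun=> c) p.
Proof. exact: near_eq_differentiable (near_local_rep_cst c) _. Qed.

Lemma diffableD F G : diffable a F p -> diffable a G p ->
  diffable a (fun q => F q + G q) p.
Proof. by rewrite /diffable local_repD; exact: differentiableD. Qed.

Lemma diffableN F : diffable a F p -> diffable a (fun q => - F q) p.
Proof. by rewrite /diffable local_repN; exact: differentiableN. Qed.

Lemma diffableM F G : diffable a F p -> diffable a G p ->
  diffable a (fun q => F q * G q) p.
Proof. by rewrite /diffable local_repM; exact: differentiableM. Qed.

Lemma diffableV F : F p != 0 -> diffable a F p ->
  diffable a (fun q => (F q)^-1) p.
Proof.
move=> Fp dF; rewrite /diffable local_repV; apply: differentiableV => //.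
by rewrite local_rep_at.
Qed.

Lemma diffable_sum (I : Type) (r : seq I) (F : I -> T -> R) :
  (forall i, diffable a (F i) p) ->
  diffable a (fun q => \sum_(i <- r) F i q) p.
Proof.
move=> dF; elim: r => [|i r ih].
  by apply: diffable_ext (diffable_cst 0) => q _; rewrite big_nil.
by apply: diffable_ext (diffableD (dF i) ih) => q _; rewrite big_cons.
Qed.

Lemma diffable_prod (I : Type) (r : seq I) (F : I -> T -> R) :
  (forall i, diffable a (F i) p) ->
  diffable a (fun q => \prod_(i <- r) F i q) p.
Proof.
move=> dF; elim: r => [|i r ih].
  by apply: diffable_ext (diffable_cst 1) => q _; rewrite big_nil.
by apply: diffable_ext (diffableM (dF i) ih) => q _; rewrite big_cons.
Qed.

Lemma dirv_cst v c : dirv a v (fun=> c) p = 0.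
Proof.
rewrite (dirvE _ (diffable_cst c)) -(derive_cst c (ccoord a p) v).
exact/esym/near_eq_derive/near_local_rep_cst.
Qed.

Lemma dirvD v F G : diffable a F p -> diffable a G p ->
  dirv a v (fun q => F q + G q) p = dirv a v F p + dirv a v G p.
Proof.
move=> dF dG; rewrite !dirvE//; last exact: diffableD.
by rewrite local_repD deriveD//; exact: diff_derivable.
Qed.

Lemma dirvN v F : diffable a F p ->
  dirv a v (fun q => - F q) p = - dirv a v F p.
Proof.
move=> dF; rewrite !dirvE//; last exact: diffableN.
by rewrite local_repN deriveN//; exact: diff_derivable.
Qed.

Lemma dirvM v F G : diffable a F p -> diffable a G p ->
  dirv a v (fun q => F q * G q) p = dirv a v F p * G p + F p * dirv a v G p.
Proof.
move=> dF dG; rewrite !dirvE//; last exact: diffableM.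
rewrite local_repM deriveM; [|exact: diff_derivable..].
by rewrite !local_rep_at// /GRing.scale/= addrC mulrC.
Qed.

Lemma dirv_sum v (I : Type) (r : seq I) (F : I -> T -> R) :
  (forall i, diffable a (F i) p) ->
  dirv a v (fun q => \sum_(i <- r) F i q) p = \sum_(i <- r) dirv a v (F i) p.
Proof.
move=> dF; elim: r => [|i r ih].
  rewrite big_nil -[RHS](dirv_cst v 0).
  by apply: dirv_ext => q _; rewrite big_nil.
rewrite big_cons -ih -dirvD//; last exact: diffable_sum.
by apply: dirv_ext => q _; rewrite big_cons.
Qed.

Lemma diffable_coord k : diffable a (fun q => ccoord a q 0 k) p.
Proof.
apply: near_eq_differentiable (differentiable_coord (ccoord a p) 0 k).
by apply: filterS (near_local_rep pa ap) => x [q aq [<- ->]].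
Qed.

Lemma dirv_coord v k : dirv a v (fun q => ccoord a q 0 k) p = v 0 k.
Proof.
rewrite (dirvE _ (diffable_coord k)).
have -> : 'D_v (local_rep a (fun q => ccoord a q 0 k)) (ccoord a p) =
  'D_v (fun x : 'rV[R]_m => x 0 k) (ccoord a p).
  apply: near_eq_derive.
  by apply: filterS (near_local_rep pa ap) => x [q aq [<- ->]].
have := derive_mx (@derivable_id _ _ (ccoord a p) v).
by rewrite derive_id => /matrixP/(_ 0 k); rewrite mxE.
Qed.

End At.
End ChartCalculus.

(** * Matrix-valued functions on a manifold *)
Section MixedDerivatives.
Context {R : realType} {T : Type} {m : nat} {N : charts R T m}.
Context (a : cidx N) (p : T) (pa : proper_chart a) (ap : cdom a p).
Implicit Types (F : T -> R).

Lemma smooth_diffable F q : smooth_on a (cdom a) F -> cdom a q -> diffable a F q.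
Proof. by move=> sF aq; exact: (sF [::]). Qed.

Lemma smooth_diffable_dirv F v q : smooth_on a (cdom a) F -> cdom a q ->
  diffable a (dirv a v F) q.
Proof.
move=> sF aq; apply: diffable_sum => // i; apply: diffableM => //.
  exact: diffable_cst.
exact: (sF [:: i]).
Qed.

Lemma near_local_rep_dirv F v : smooth_on a (cdom a) F ->
  {near ccoord a p, local_rep a (dirv a v F) =1 'D_v (local_rep a F)}.
Proof.
move=> sF; apply: filterS (near_local_rep pa ap) => x [q aq [<- ->]].
by rewrite dirvE//; exact: smooth_diffable.
Qed.

Lemma dirv_comm F v w : smooth_on a (cdom a) F ->
  dirv a v (dirv a w F) p = dirv a w (dirv a v F) p.
Proof.
move=> sF.
have E u u' : dirv a u (dirv a u' F) p =
    'D_u ('D_u' (local_rep a F)) (ccoord a p).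
  rewrite dirvE; last exact: smooth_diffable_dirv.
  exact/near_eq_derive/near_local_rep_dirv.
have dD u : differentiable ('D_u (local_rep a F)) (ccoord a p).
  apply: near_eq_differentiable (near_local_rep_dirv u sF) _.
  exact: smooth_diffable_dirv.
rewrite !E; apply: derive_comm => //.
apply: filterS (near_local_rep pa ap) => x [q aq [<- _]].
exact: smooth_diffable.
Qed.

End MixedDerivatives.

Lemma trmxD (V : zmodType) r c (A B : 'M[V]_(r, c)) : (A + B)^T = A^T + B^T.
Proof. by apply/matrixP => i j; rewrite !mxE. Qed.

Lemma trmxN (V : zmodType) r c (A : 'M[V]_(r, c)) : (- A)^T = - A^T.
Proof. by apply/matrixP => i j; rewrite !mxE. Qed.

Section MatrixCalculus.
Context {R : realType} {T : Type} {m : nat} {N : charts R T m}.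
Implicit Types (a : cidx N) (p q : T) (v w : 'rV[R]_m).

Definition mdiff a r c (F : T -> 'M[R]_(r, c)) p :=
  forall i j, diffable a (fun q => F q i j) p.

Definition dirm a v r c (F : T -> 'M[R]_(r, c)) p : 'M[R]_(r, c) :=
  \matrix_(i, j) dirv a v (fun q => F q i j) p.

Lemma dirm_ext a v r c (F G : T -> 'M[R]_(r, c)) p :
  (forall q, cdom a q -> F q = G q) -> dirm a v F p = dirm a v G p.
Proof.
by move=> FG; apply/matrixP => i j; rewrite !mxE; apply: dirv_ext => q /FG ->.
Qed.

Lemma dirm_linear a r c (F : T -> 'M[R]_(r, c)) p k v w :
  dirm a (k *: v + w) F p = k *: dirm a v F p + dirm a w F p.
Proof. by apply/matrixP => i j; rewrite !mxE dirv_linear. Qed.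

Lemma dirm0 a r c (F : T -> 'M[R]_(r, c)) p : dirm a 0 F p = 0.
Proof. by apply/matrixP => i j; rewrite !mxE dirv0. Qed.

Lemma mdiff_tr a r c (F : T -> 'M[R]_(r, c)) p :
  mdiff a F p -> mdiff a (fun q => (F q)^T) p.
Proof.
move=> dF i j; rewrite (_ : (fun q => _) = (fun q => F q j i)); first exact: dF.
by apply/funext => q; rewrite mxE.
Qed.

Lemma dirm_tr a v r c (F : T -> 'M[R]_(r, c)) p :
  dirm a v (fun q => (F q)^T) p = (dirm a v F p)^T.
Proof.
by apply/matrixP => i j; rewrite !mxE; apply: dirv_ext => q _; rewrite mxE.
Qed.

Section At.
Context (a : cidx N) (p : T) (pa : proper_chart a) (ap : cdom a p).

Lemma mdiff_cst r c (A : 'M[R]_(r, c)) : mdiff a (fun=> A) p.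
Proof. by move=> i j; exact: diffable_cst. Qed.

Lemma dirm_cst v r c (A : 'M[R]_(r, c)) : dirm a v (fun=> A) p = 0.
Proof. by apply/matrixP => i j; rewrite !mxE dirv_cst. Qed.

Lemma mdiffD r c (F G : T -> 'M[R]_(r, c)) : mdiff a F p -> mdiff a G p ->
  mdiff a (fun q => F q + G q) p.
Proof.
move=> dF dG i j; apply: diffable_ext (diffableD pa (dF i j) (dG i j)) => q _.
by rewrite mxE.
Qed.

Lemma mdiffN r c (F : T -> 'M[R]_(r, c)) : mdiff a F p ->
  mdiff a (fun q => - F q) p.
Proof.
move=> dF i j; apply: diffable_ext (diffableN pa (dF i j)) => q _.
by rewrite mxE.
Qed.

Lemma mdiffM r k c (F : T -> 'M[R]_(r, k)) (G : T -> 'M[R]_(k, c)) :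
  mdiff a F p -> mdiff a G p -> mdiff a (fun q => F q *m G q) p.
Proof.
move=> dF dG i j; rewrite (_ : (fun q => _) = (fun q => \sum_l F q i l * G q l j)).
  by apply: diffable_sum => // l; exact: diffableM.
by apply/funext => q; rewrite mxE.
Qed.

Lemma dirmD v r c (F G : T -> 'M[R]_(r, c)) : mdiff a F p -> mdiff a G p ->
  dirm a v (fun q => F q + G q) p = dirm a v F p + dirm a v G p.
Proof.
move=> dF dG; apply/matrixP => i j; rewrite !mxE -dirvD//.
by apply: dirv_ext => q _; rewrite mxE.
Qed.

Lemma dirmN v r c (F : T -> 'M[R]_(r, c)) : mdiff a F p ->
  dirm a v (fun q => - F q) p = - dirm a v F p.
Proof.
move=> dF; apply/matrixP => i j; rewrite !mxE -dirvN//.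
by apply: dirv_ext => q _; rewrite mxE.
Qed.

Lemma dirmM v r k c (F : T -> 'M[R]_(r, k)) (G : T -> 'M[R]_(k, c)) :
  mdiff a F p -> mdiff a G p ->
  dirm a v (fun q => F q *m G q) p = dirm a v F p *m G p + F p *m dirm a v G p.
Proof.
move=> dF dG; apply/matrixP => i j; rewrite !mxE.
rewrite (dirv_ext _ (G := fun q => \sum_l F q i l * G q l j)); last first.
  by move=> q _; rewrite mxE.
rewrite dirv_sum//; last by move=> l; exact: diffableM.
rewrite -big_split/=; apply: eq_bigr => l _.
by rewrite dirvM// !mxE.
Qed.

Lemma diffable_det k (F : T -> 'M[R]_k) : mdiff a F p ->
  diffable a (fun q => \det (F q)) p.
Proof.
move=> dF; apply: diffable_sum => // s; apply: diffableM => //.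
  exact: diffable_cst.
by apply: diffable_prod => // i; exact: dF.
Qed.

Lemma mdiff_inv k (F : T -> 'M[R]_k) :
  (forall q, cdom a q -> F q \in unitmx) -> mdiff a F p ->
  mdiff a (fun q => invmx (F q)) p.
Proof.
move=> uF dF i j.
apply: (diffable_ext (F := fun q => (\det (F q))^-1 * cofactor (F q) j i)).
  by move=> q aq; rewrite /invmx uF// !mxE.
apply: diffableM => //.
  apply: diffableV => //; last exact: diffable_det.
  by have := uF _ ap; rewrite unitmxE unitfE.
apply: diffableM => //; first exact: diffable_cst.
apply: diffable_det => h l.
rewrite (_ : (fun q => _) = (fun q => F q (lift j h) (lift i l))); first exact: dF.
by apply/funext => q; rewrite !mxE.
Qed.

Lemma dirm_inv v k (F : T -> 'M[R]_k) :
  (forall q, cdom a q -> F q \in unitmx) -> mdiff a F p ->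
  dirm a v (fun q => invmx (F q)) p =
    - (invmx (F p) *m dirm a v F p *m invmx (F p)).
Proof.
move=> uF dF; have dI := mdiff_inv uF dF.
have : dirm a v (fun q => F q *m invmx (F q)) p = 0.
  rewrite -(dirm_cst v (1%:M : 'M[R]_k)); apply: dirm_ext => q aq.
  by rewrite mulmxV// uF.
rewrite dirmM// => E.
have := congr1 (mulmx (invmx (F p))) E.
rewrite mulmxDr mulmx0 !mulmxA mulVmx ?uF// mul1mx => /eqP.
by rewrite addr_eq0 => /eqP->; rewrite opprK.
Qed.

Lemma dirv_trace v k (F : T -> 'M[R]_k) : mdiff a F p ->
  dirv a v (fun q => \tr (F q)) p = \tr (dirm a v F p).
Proof.
move=> dF; rewrite /mxtrace dirv_sum //.
by apply: eq_bigr => i _; rewrite mxE.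
Qed.

End At.
End MatrixCalculus.

(** * Metrics, connection forms and curvature forms *)
Section MatrixForms.
Context {R : realType}.

Lemma bilinE m (G : 'M[R]_m) (v w : 'rV[R]_m) :
  bilin G v w = (v *m G *m w^T) 0 0.
Proof.
rewrite mxE /bilin exchange_big/=; apply: eq_bigr => j _.
by rewrite !mxE mulr_suml; apply: eq_bigr => i _; rewrite (mulrC (v 0 i)).
Qed.

Lemma bilinDl m (G : 'M[R]_m) u v w : bilin G (u + v) w = bilin G u w + bilin G v w.
Proof. by rewrite !bilinE !mulmxDl mxE. Qed.

Lemma bilinDr m (G : 'M[R]_m) u v w : bilin G u (v + w) = bilin G u v + bilin G u w.
Proof. by rewrite !bilinE trmxD mulmxDr mxE. Qed.

Lemma bilinNl m (G : 'M[R]_m) v w : bilin G (- v) w = - bilin G v w.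
Proof. by rewrite !bilinE !mulNmx mxE. Qed.

Lemma bilinZl m (G : 'M[R]_m) c v w : bilin G (c *: v) w = c * bilin G v w.
Proof. by rewrite !bilinE -!scalemxAl mxE. Qed.

Lemma bilin0l m (G : 'M[R]_m) w : bilin G 0 w = 0.
Proof. by rewrite bilinE !mul0mx mxE. Qed.

End MatrixForms.

Section Metric.
Context {R : realType} {T : Type} {m : nat} {N : charts R T m} (g : metric N).
Context (a : cidx N) (p : T) (ap : cdom a p).

Lemma metric_tr : (g a p)^T = g a p.
Proof. by apply/matrixP => i j; rewrite mxE gcomp_sym. Qed.

Lemma metric_bilinC v w : bilin (g a p) v w = bilin (g a p) w v.
Proof.
rewrite !bilinE; transitivity ((v *m g a p *m w^T)^T 0 0); first by rewrite [RHS]mxE.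
by rewrite !trmx_mul trmxK metric_tr mulmxA.
Qed.

Lemma metric_nondegenerate v :
  (forall w, bilin (g a p) v w = 0) -> v = 0.
Proof.
move=> v0; apply/eqP; apply: contraT => /(gcomp_posdef g ap) vv.
by rewrite v0 ltxx in vv.
Qed.

Lemma metric_unit : g a p \in unitmx.
Proof.
rewrite -row_free_unit -kermx_eq0; apply/eqP/row_matrixP => i; rewrite row0.
apply: metric_nondegenerate => w.
by rewrite bilinE -row_mul mulmx_ker row0 mul0mx mxE.
Qed.

Lemma ginv_tr : (ginv g a p)^T = ginv g a p.
Proof. by rewrite /ginv trmx_inv metric_tr. Qed.

End Metric.

Section ConnectionForm.
Context {R : realType} {T : Type} {m : nat} {N : charts R T m}.
Context (D : connection N).
Implicit Types (a : cidx N) (p q : T) (x y z : 'rV[R]_m).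

(** The matrix of the endomorphism of the tangent space sending [y] to
    Gamma(x, y). *)
Definition conn_form a p x : 'M[R]_m := \matrix_(h, j) \sum_i D a p h i j * x 0 i.

(** The derivative along [x] of the connection form in the direction of the
    constant field [y]. *)
Definition dconn_form a p x y : 'M[R]_m := dirm a x (fun q => conn_form a q y) p.

End ConnectionForm.

(* Proves an identity between sums of matrices, up to the laws of a module over
   a commutative ring: products and derivatives are made opaque before the
   entries are compared, so that they are not expanded. *)
Ltac mx_module :=
  repeat (let P := fresh in set P := (_ *m _); clearbody P);
  repeat (let P := fresh in set P := dirm _ _ _ _; clearbody P);
  repeat (let P := fresh in set P := dconn_form _ _ _ _ _; clearbody P);
  let i := fresh in let j := fresh in
  apply/matrixP => i j; rewrite !mxE; ring.

Section Connection.
Context {R : realType} {T : Type} {m : nat} {N : charts R T m}.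
Context (D : connection N).
Implicit Types (a : cidx N) (p q : T) (x y z : 'rV[R]_m).

Local Notation conn_form := (conn_form D).
Local Notation dconn_form := (dconn_form D).

Lemma nablaE (X Y : vfamily N) a p :
  nabla D X Y a p = dirm a (X a p) (Y a) p + Y a p *m (conn_form a p (X a p))^T.
Proof.
apply/rowP => h; rewrite !mxE; congr (_ + _).
rewrite exchange_big/=; apply: eq_bigr => j _.
rewrite !mxE mulr_sumr; apply: eq_bigr => i _.
by rewrite mulrC mulrA.
Qed.

Lemma nabla11E (X : vfamily N) (B : mfamily N) a p :
  nabla11 D X B a p = dirm a (X a p) (B a) p +
    (conn_form a p (X a p) *m B a p - B a p *m conn_form a p (X a p)).
Proof.
apply/matrixP => i j; rewrite !mxE; congr (_ + _).
rewrite -sumrB (eq_bigr (fun s => \sum_k (D a p i s k * X a p 0 s * B a p k j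
   - B a p i k * (D a p k s j * X a p 0 s)))).
  rewrite exchange_big/=; apply: eq_bigr => k _.
  by rewrite sumrB !mxE mulr_suml mulr_sumr.
by move=> s _; rewrite mulr_sumr; apply: eq_bigr => k _; ring.
Qed.

Lemma conn_form_linear a p k x y :
  conn_form a p (k *: x + y) = k *: conn_form a p x + conn_form a p y.
Proof.
apply/matrixP => h j; rewrite !mxE mulr_sumr -big_split/=.
by apply: eq_bigr => i _; rewrite !mxE; ring.
Qed.

Lemma mdiff_conn_form a p x : proper_chart a -> cdom a p ->
  mdiff a (fun q => conn_form a q x) p.
Proof.
move=> pa ap h j.
apply: (diffable_ext (F := fun q => \sum_i D a q h i j * x 0 i)).
  by move=> q _; rewrite mxE.
apply: diffable_sum => // i; apply: diffableM => //; last exact: diffable_cst.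
exact: (@con_smooth _ _ _ _ D a h i j [::]).
Qed.

(** The matrix of R(x, y): the structure equation for the commuting fields [x]
    and [y] with constant components. *)
Definition curv_form a p x y : 'M[R]_m :=
  dconn_form a p x y - dconn_form a p y x
  + (conn_form a p x *m conn_form a p y - conn_form a p y *m conn_form a p x).

Lemma curv_formN a p x y : curv_form a p y x = - curv_form a p x y.
Proof. by rewrite /curv_form opprD !opprB. Qed.

Lemma curv_form_linearl a p k x y z : proper_chart a -> cdom a p ->
  curv_form a p (k *: x + y) z = k *: curv_form a p x z + curv_form a p y z.
Proof.
move=> pa ap; rewrite /curv_form conn_form_linear.
have -> : dconn_form a p (k *: x + y) z = k *: dconn_form a p x z + dconn_form a p y z.
  exact: dirm_linear.
have -> : dconn_form a p z (k *: x + y) = k *: dconn_form a p z x + dconn_form a p z y.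
  rewrite /dconn_form.
  rewrite (dirm_ext _ (G := fun q => k%:M *m conn_form a q x + conn_form a q y)); last first.
    by move=> q _; rewrite conn_form_linear mul_scalar_mx.
  have dk := mdiff_cst pa ap k%:M; have dx := mdiff_conn_form x pa ap.
  rewrite dirmD//; [|exact: mdiffM|exact: mdiff_conn_form].
  by rewrite dirmM// dirm_cst// mul0mx add0r mul_scalar_mx.
rewrite mulmxDl mulmxDr -scalemxAl -scalemxAr !scalerDr !scalerN.
mx_module.
Qed.

Lemma curv_form_suml a p y (I : Type) (r : seq I) (c : I -> R) (x : I -> 'rV[R]_m) :
  proper_chart a -> cdom a p ->
  curv_form a p (\sum_(i <- r) c i *: x i) y = \sum_(i <- r) c i *: curv_form a p (x i) y.
Proof.
move=> pa ap; elim: r => [|i r ih]; last by rewrite !big_cons curv_form_linearl// ih.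
rewrite !big_nil; have := curv_form_linearl (-1) 0 0 y pa ap.
by rewrite scaler0 addr0 scaleN1r addNr.
Qed.

Lemma curv_form_sumr a p y (I : Type) (r : seq I) (c : I -> R) (x : I -> 'rV[R]_m) :
  proper_chart a -> cdom a p ->
  curv_form a p y (\sum_(i <- r) c i *: x i) = \sum_(i <- r) c i *: curv_form a p y (x i).
Proof.
move=> pa ap; rewrite curv_formN curv_form_suml// -sumrN.
by apply: eq_bigr => i _; rewrite -scalerN -curv_formN.
Qed.

Lemma curv_form_Rcomp a p k l j s : proper_chart a -> cdom a p ->
  Rcomp D a p k l j s = curv_form a p (delta_mx 0 k) (delta_mx 0 l) s j.
Proof.
move=> pa ap; rewrite /Rcomp /curvature.
have br0 : bracket (coord_field k) (coord_field l) a p = 0.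
  have z X i h : dirder X (fun q => coord_field i a q 0 h) a p = 0 :> R.
    exact: (dirv_cst pa ap (X a p)).
  by apply/rowP => h; rewrite mxE !z subrr mxE.
have E i i' : nabla D (coord_field i) (nabla D (coord_field i') (coord_field j)) a p
    = delta_mx 0 j *m (conn_form a p (delta_mx 0 i) *m conn_form a p (delta_mx 0 i')
         + dconn_form a p (delta_mx 0 i) (delta_mx 0 i'))^T.
  have E1 q : cdom a q -> nabla D (coord_field i') (coord_field j) a q =
      delta_mx 0 j *m (conn_form a q (delta_mx 0 i'))^T.
    by move=> aq; rewrite nablaE /coord_field dirm_cst// add0r.
  rewrite nablaE E1// (dirm_ext _ _ E1) dirmM//; last 2 first.
    exact: mdiff_cst.
    exact/mdiff_tr/mdiff_conn_form.
  rewrite dirm_cst// mul0mx add0r dirm_tr linearD/= trmx_mul mulmxDr mulmxA.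
  by rewrite addrC.
rewrite !E [nabla D (bracket _ _) _ _ _]nablaE br0 dirm0 add0r.
have -> : conn_form a p 0 = 0.
  by have := conn_form_linear a p (-1) 0 0; rewrite scaler0 addr0 scaleN1r addNr.
rewrite trmx0 mulmx0 subr0 -mulmxBr -trmxN -trmxD.
rewrite -rowE [LHS]mxE [LHS]mxE.
congr (fun_of_matrix _ s j); rewrite /curv_form.
mx_module.
Qed.

End Connection.

Section LeviCivita.
Context {R : realType} {T : Type} {m : nat} {N : charts R T m}.
Context (g : metric N) (D : connection N) (hD : levi_civita g D).
Context (a : cidx N) (pa : proper_chart a).
Implicit Types (p q : T) (x y z w : 'rV[R]_m).

Lemma mdiff_metric p : cdom a p -> mdiff a (g a) p.
Proof. by move=> ap i j; exact: (@gcomp_smooth _ _ _ _ g a i j [::]). Qed.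

Lemma mdiff_ginv p : cdom a p -> mdiff a (ginv g a) p.
Proof.
by move=> ap; apply: mdiff_inv => //; [exact: metric_unit|exact: mdiff_metric].
Qed.

Lemma dirm_metric p x : cdom a p ->
  dirm a x (g a) p = (conn_form D a p x)^T *m g a p + g a p *m conn_form D a p x.
Proof.
move=> ap; apply/matrixP => i j; rewrite !mxE /dirv.
under eq_bigr => k _ do rewrite (hD.2 a p ap) mulr_sumr.
rewrite exchange_big/= -big_split/=; apply: eq_bigr => l _.
rewrite !mxE mulr_suml mulr_sumr -big_split/=; apply: eq_bigr => k _; ring.
Qed.

Lemma dirm_ginv p x : cdom a p ->
  dirm a x (ginv g a) p =
  - (ginv g a p *m (conn_form D a p x)^T + conn_form D a p x *m ginv g a p).
Proof.
move=> ap; rewrite dirm_inv//; [|exact: metric_unit|exact: mdiff_metric].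
rewrite dirm_metric// mulmxDr mulmxDl -!mulmxA -/(ginv g a p).
by rewrite mulmxV ?metric_unit// mulmx1 mulKmx ?metric_unit.
Qed.

Lemma conn_form_sym p x y : cdom a p ->
  y *m (conn_form D a p x)^T = x *m (conn_form D a p y)^T.
Proof.
move=> ap; apply/rowP => h; rewrite !mxE.
under eq_bigr do rewrite !mxE mulr_sumr.
rewrite exchange_big/=; apply: eq_bigr => i _; rewrite !mxE mulr_sumr.
by apply: eq_bigr => j _; rewrite (hD.1 a p ap h i j); ring.
Qed.

(** Two derivatives of the metric, expressed by the connection forms, commute. *)
Lemma curv_form_skew p x y : cdom a p ->
  (curv_form D a p x y)^T *m g a p = - (g a p *m curv_form D a p x y).
Proof.
move=> ap.
have E u v : dirm a u (dirm a v (g a)) p =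
    (dconn_form D a p u v)^T *m g a p
    + (conn_form D a p v)^T *m ((conn_form D a p u)^T *m g a p + g a p *m conn_form D a p u)
    + (((conn_form D a p u)^T *m g a p + g a p *m conn_form D a p u) *m conn_form D a p v
       + g a p *m dconn_form D a p u v).
  rewrite (dirm_ext _ _ (fun q => @dirm_metric q v)).
  have dg := mdiff_metric ap; have dw := mdiff_conn_form D v pa ap.
  have dwt := mdiff_tr dw.
  rewrite dirmD//; [|exact: mdiffM..].
  by rewrite !dirmM// dirm_tr dirm_metric.
have : dirm a x (dirm a y (g a)) p = dirm a y (dirm a x (g a)) p.
  apply/matrixP => i j; rewrite !mxE.
  transitivity (dirv a x (dirv a y (fun q => g a q i j)) p).
    by apply: dirv_ext => q _; rewrite mxE.
  rewrite dirv_comm//; last exact: gcomp_smooth.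
  by apply: dirv_ext => q _; rewrite mxE.
rewrite !E /curv_form.
rewrite !(trmxD, trmxN) !trmx_mul !(mulmxDl, mulmxDr, mulNmx, mulmxN) !mulmxA => /eqP.
rewrite -subr_eq0 => /eqP H; apply/eqP; rewrite -subr_eq0 -H; apply/eqP.
mx_module.
Qed.

(** The quadratic terms cancel, and so do the derivatives of the symmetric
    Christoffel symbols. *)
Lemma curv_form_bianchi p x y z : cdom a p ->
  z *m (curv_form D a p x y)^T + x *m (curv_form D a p y z)^T
    + y *m (curv_form D a p z x)^T = 0.
Proof.
move=> ap.
have S u v w : v *m (dconn_form D a p u w)^T = w *m (dconn_form D a p u v)^T.
  have E s t : t *m (dconn_form D a p u s)^T =
               dirm a u (fun q => t *m (conn_form D a q s)^T) p.
    have ds := mdiff_tr (mdiff_conn_form D s pa ap).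
    rewrite dirmM//; last exact: mdiff_cst.
    by rewrite dirm_cst// mul0mx add0r dirm_tr.
  transitivity (dirm a u (fun q => v *m (conn_form D a q w)^T) p); first exact: E.
  transitivity (dirm a u (fun q => w *m (conn_form D a q v)^T) p).
    by apply: dirm_ext => q aq; exact: conn_form_sym.
  exact/esym/E.
rewrite /curv_form !(trmxD, trmxN) !trmx_mul !(mulmxDr, mulmxN) !mulmxA.
rewrite (S x z y) (S y z x) (S z x y).
rewrite (conn_form_sym z y ap) (conn_form_sym z x ap) (conn_form_sym x y ap).
mx_module.
Qed.

Definition riem p x y z w : R := bilin (g a p) (z *m (curv_form D a p x y)^T) w.

(** Put each of the arguments in turn in the last place of the Bianchi identity.
    Up to antisymmetry the four identities have six terms, and the sum of the
    first two identities minus that of the others is twice the claim. *)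
Lemma riem_pair p x y z w : cdom a p -> riem p x y z w = riem p z w x y.
Proof.
move=> ap.
have A1 u v s t : riem p v u s t = - riem p u v s t.
  by rewrite /riem curv_formN linearN/= mulmxN bilinNl.
have A2 u v s t : riem p u v t s = - riem p u v s t.
  rewrite /riem [in RHS]metric_bilinC// !bilinE -(mulmxA t) curv_form_skew//.
  by rewrite trmx_mul trmxK mulmxN mulNmx mxE !mulmxA.
have B u v s t : riem p u v s t + riem p v s u t + riem p s u v t = 0.
  by rewrite /riem -!bilinDl curv_form_bianchi// bilin0l.
have := B x y z w; have := B y z w x; have := B z w x y; have := B w x y z.
rewrite (A1 x w y z) (A2 x y z w) (A2 y w z x).
rewrite (A1 x w z y) (A2 x w y z) (A1 z x w y) (A2 z x y w).
rewrite (A2 y z x w) (A2 z w x y) (A1 y w z x).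
lra.
Qed.

End LeviCivita.

(** * The Koszul formula *)
Section Koszul.
Context {R : realType} {T : Type} {m : nat} {N : charts R T m}.
Context (g : metric N) (D : connection N) (hD : levi_civita g D).
Context (a : cidx N) (p : T) (pa : proper_chart a) (ap : cdom a p).
Implicit Types (X Y Z : vfamily N).

Lemma metric_compat X Y Z : mdiff a (Y a) p -> mdiff a (Z a) p ->
  dirder X (fun q => bilin (g a q) (Y a q) (Z a q)) a p =
  bilin (g a p) (nabla D X Y a p) (Z a p) + bilin (g a p) (Y a p) (nabla D X Z a p).
Proof.
move=> dY dZ; have dg := mdiff_metric g ap.
transitivity (dirm a (X a p) (fun q => Y a q *m g a q *m (Z a q)^T) p 0 0).
  by rewrite [RHS]mxE; apply: dirv_ext => q _; rewrite bilinE.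
have dZt := mdiff_tr dZ; have dYg : mdiff a (fun q => Y a q *m g a q) p by exact: mdiffM.
rewrite !dirmM// dirm_tr (dirm_metric hD)// !bilinE !nablaE.
set w := conn_form _ _ _ _; set dy := dirm _ _ _ _; set dz := dirm _ _ _ _.
rewrite !(linearD, trmx_mul, trmxK)/= !(mulmxDl, mulmxDr) !mulmxA.
by rewrite !trmx_mul !trmxK !mulmxA !mxE; ring.
Qed.

Lemma bracketE X Y :
  bracket X Y a p = dirm a (X a p) (Y a) p - dirm a (Y a p) (X a) p.
Proof. by apply/rowP => h; rewrite !mxE. Qed.

Lemma torsion_free X Y : nabla D X Y a p = nabla D Y X a p + bracket X Y a p.
Proof.
rewrite !nablaE bracketE (conn_form_sym hD (X a p) (Y a p) ap).
by rewrite [RHS]addrC addrA subrK.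
Qed.

Lemma koszul X Y Z : mdiff a (X a) p -> mdiff a (Y a) p -> mdiff a (Z a) p ->
  2 * bilin (g a p) (nabla D X Y a p) (Z a p) =
    dirder X (fun q => bilin (g a q) (Y a q) (Z a q)) a p
  + dirder Y (fun q => bilin (g a q) (X a q) (Z a q)) a p
  - dirder Z (fun q => bilin (g a q) (X a q) (Y a q)) a p
  + bilin (g a p) (bracket X Y a p) (Z a p)
  - bilin (g a p) (bracket X Z a p) (Y a p)
  - bilin (g a p) (bracket Y Z a p) (X a p).
Proof.
move=> dX dY dZ; rewrite !metric_compat//.
rewrite (torsion_free X Y) (torsion_free X Z) (torsion_free Y Z) !bilinDl !bilinDr.
rewrite (metric_bilinC g ap (X a p)) (metric_bilinC g ap (Y a p) (nabla _ _ _ _ _)).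
rewrite (metric_bilinC g ap (Y a p) (bracket _ _ _ _)).
rewrite (metric_bilinC g ap (X a p) (bracket _ _ _ _)).
by ring.
Qed.

End Koszul.

(** * Calculus in the induced charts *)
Section InducedCharts.
Context {R : realType} {T : Type} {n : nat} {M : charts R T n}.
Local Notation TM := (T11_charts M).

(** The components of a tensor in one chart determine those in the others. *)
Lemma T11_coord_inj (a : cidx M) : {in cdom a &, injective (ccoord a)} ->
  {in @cdom _ _ _ TM a &, injective (@ccoord _ _ _ TM a)}.
Proof.
move=> inj t t'; rewrite !inE => at_ at' /= /eq_row_mx[/(inj _ _) bE].
move=> /(can_inj mxvecK) tE.
have {}bE : base t = base t' by apply: bE; rewrite inE.
have {}tE : tens t = tens t'.
  apply/funext => b; have [bt|bt] := pselect (cdom b (base t)).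
    apply/matrixP => i j; rewrite (tens_change at_ bt) (@tens_change _ _ _ _ _ a b) -?bE//.
    by rewrite tE.
  by rewrite !tens_out// -bE.
case: t t' at_ at' bE tE => [p tp p1 p2] [p' tp' p1' p2'] /= _ _ E1 E2.
by subst p' tp'; congr T11Point; exact: Prop_irrelevance.
Qed.

Context (a : cidx M) (pM : proper_chart a) (pT : @proper_chart _ _ _ TM a).
Context (t : T11 M) (at_ : cdom a (base t)).
Let atT : @cdom _ _ _ TM a t := at_.

Lemma near_local_rep_base (F : T -> R) :
  {near @ccoord _ _ _ TM a t, (local_rep a F \o lsubmx) =1
     @local_rep _ _ _ TM a (F \o @base _ _ _ M)}.
Proof.
apply: filterS (near_local_rep pT atT) => _ [t' at' [<- ->]].
by rewrite /= row_mxKl local_rep_at//; case: pM.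
Qed.

Lemma diffable_base (F : T -> R) : diffable a F (base t) ->
  @diffable _ _ _ TM a (F \o @base _ _ _ M) t.
Proof.
move=> dF; apply: near_eq_differentiable (near_local_rep_base F) _.
apply: differentiable_comp; first exact: differentiable_lsubmx.
by rewrite row_mxKl.
Qed.

Lemma dirv_base v (F : T -> R) : diffable a F (base t) ->
  @dirv _ _ _ TM a v (F \o @base _ _ _ M) t = dirv a (lsubmx v) F (base t).
Proof.
move=> dF; rewrite !dirvE//; last exact: diffable_base.
rewrite -(near_eq_derive _ (near_local_rep_base F)).
have dl := differentiable_lsubmx (@ccoord _ _ _ TM a t).
have dF' : differentiable (local_rep a F) (lsubmx (@ccoord _ _ _ TM a t)).
  by rewrite row_mxKl.
rewrite deriveE; last exact: differentiable_comp.
rewrite diff_comp//= deriveE// row_mxKl.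
congr ('d _ _ _).
by rewrite diff_lin//; exact: continuous_lsubmx.
Qed.

Lemma mdiff_base r c (F : T -> 'M[R]_(r, c)) : mdiff a F (base t) ->
  @mdiff _ _ _ TM a _ _ (fun t => F (base t)) t.
Proof. by move=> dF i j; exact: (diffable_base (dF i j)). Qed.

Lemma dirm_base v r c (F : T -> 'M[R]_(r, c)) : mdiff a F (base t) ->
  @dirm _ _ _ TM a v _ _ (fun t => F (base t)) t = dirm a (lsubmx v) F (base t).
Proof.
by move=> dF; apply/matrixP => i j; rewrite !mxE (dirv_base _ (dF i j)).
Qed.

Lemma tens_coord i j :
  (fun t' : T11 M => tens t' a i j) =
  (fun t' => @ccoord _ _ _ TM a t' 0 (rshift n (mxvec_index i j))).
Proof. by apply/funext => t'; rewrite /= row_mxEr mxvecE. Qed.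

Lemma mdiff_tens : @mdiff _ _ _ TM a _ _ (fun t' => tens t' a) t.
Proof. by move=> i j; rewrite tens_coord; exact: diffable_coord. Qed.

Lemma dirm_tens v :
  @dirm _ _ _ TM a v _ _ (fun t' => tens t' a) t = vec_mx (rsubmx v).
Proof. by apply/matrixP => i j; rewrite mxE tens_coord dirv_coord// !mxE. Qed.

Lemma mdiff_row_mx (F : T11 M -> 'rV[R]_n) (G : T11 M -> 'M[R]_n) :
  @mdiff _ _ _ TM a _ _ F t -> @mdiff _ _ _ TM a _ _ G t ->
  @mdiff _ _ _ TM a _ _ (fun t' => row_mx (F t') (mxvec (G t'))) t.
Proof.
move=> dF dG i j; rewrite ord1; case: (split_ordP j) => k ->.
  by apply: diffable_ext (dF 0 k) => t' _; rewrite row_mxEl.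
case/mxvec_indexP: k => k l.
by apply: diffable_ext (dG k l) => t' _; rewrite row_mxEr mxvecE.
Qed.

Lemma dirm_row_mx v (F : T11 M -> 'rV[R]_n) (G : T11 M -> 'M[R]_n) :
  @dirm _ _ _ TM a v _ _ (fun t' => row_mx (F t') (mxvec (G t'))) t =
  row_mx (@dirm _ _ _ TM a v _ _ F t) (mxvec (@dirm _ _ _ TM a v _ _ G t)).
Proof.
apply/rowP => j; rewrite mxE; case: (split_ordP j) => k ->.
  by rewrite row_mxEl mxE; apply: dirv_ext => t' _; rewrite row_mxEl.
case/mxvec_indexP: k => k l.
by rewrite row_mxEr mxvecE mxE; apply: dirv_ext => t' _; rewrite row_mxEr mxvecE.
Qed.

End InducedCharts.

(** * Lifts and their derivatives *)
Section VaryingField.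
Context {R : realType} {T : Type} {n : nat} {M : charts R T n} (D : connection M).
Context (a : cidx M) (p : T) (pM : proper_chart a) (ap : cdom a p).

Lemma mdiff_conn_form_field (X : T -> 'rV[R]_n) : mdiff a X p ->
  mdiff a (fun q => conn_form D a q (X q)) p.
Proof.
move=> dX h j.
apply: (diffable_ext (F := fun q => \sum_i D a q h i j * X q 0 i)).
  by move=> q _; rewrite mxE.
apply: diffable_sum => // i; apply: diffableM => //.
exact: (@con_smooth _ _ _ _ D a h i j [::]).
Qed.

Lemma dirm_conn_form u (X : T -> 'rV[R]_n) : mdiff a X p ->
  dirm a u (fun q => conn_form D a q (X q)) p =
  dconn_form D a p u (X p) + conn_form D a p (dirm a u X p).
Proof.
move=> dX; apply/matrixP => h j; rewrite !mxE.
have dD i : diffable a (fun q => D a q h i j) p.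
  exact: (@con_smooth _ _ _ _ D a h i j [::]).
have E (Y : T -> 'rV[R]_n) : mdiff a Y p ->
    dirv a u (fun q => conn_form D a q (Y q) h j) p =
    \sum_i (dirv a u (fun q => D a q h i j) p * Y p 0 i
            + D a p h i j * dirv a u (fun q => Y q 0 i) p).
  move=> dY.
  rewrite (dirv_ext _ (G := fun q => \sum_i D a q h i j * Y q 0 i)); last first.
    by move=> q _; rewrite mxE.
  rewrite dirv_sum//; last by move=> i; exact: diffableM.
  by apply: eq_bigr => i _; rewrite dirvM.
rewrite E// E; last exact: mdiff_cst.
rewrite -big_split/=; apply: eq_bigr => i _.
by rewrite dirv_cst// mulr0 addr0 mxE.
Qed.

End VaryingField.

Section Frame.
Context {R : realType} {T : Type} {n : nat} {M : charts R T n} (D : connection M).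
Local Notation TM := (T11_charts M).
Implicit Types (x y : 'rV[R]_n) (A B C : 'M[R]_n).

Lemma hlift_atE a (t : T11 M) x : hlift_at D a t x =
  row_mx x (mxvec (tens t a *m conn_form D a (base t) x
                   - conn_form D a (base t) x *m tens t a)).
Proof.
rewrite /hlift_at; congr (row_mx _ (mxvec _)); apply/matrixP => i j.
rewrite !mxE -sumrB.
under eq_bigr do rewrite mulr_sumr.
rewrite exchange_big/=; apply: eq_bigr => m _.
rewrite !mxE mulr_suml mulr_sumr -sumrB; apply: eq_bigr => s _; ring.
Qed.

Lemma vlift_at_linear k A B :
  vlift_at (k *: A + B) = k *: vlift_at A + vlift_at B.
Proof. by rewrite /vlift_at linearP scale_row_mx add_row_mx scaler0 addr0. Qed.

Lemma hlift_at_linear a (t : T11 M) k x y :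
  hlift_at D a t (k *: x + y) = k *: hlift_at D a t x + hlift_at D a t y.
Proof.
rewrite !hlift_atE conn_form_linear scale_row_mx add_row_mx -linearP.
congr (row_mx _ (mxvec _)).
rewrite mulmxDl mulmxDr -scalemxAl -scalemxAr.
mx_module.
Qed.

Lemma vlift_at0 : vlift_at (0 : 'M[R]_n) = 0.
Proof. by rewrite /vlift_at linear0 row_mx0. Qed.

Lemma hlift_at0 a (t : T11 M) : hlift_at D a t 0 = 0.
Proof.
by have := hlift_at_linear a t (-1) 0 0; rewrite scaler0 addr0 scaleN1r addNr.
Qed.

Lemma vlift_atD A B : vlift_at (A + B) = vlift_at A + vlift_at B.
Proof. by have := vlift_at_linear 1 A B; rewrite !scale1r. Qed.

Lemma vlift_atN A : vlift_at (- A) = - vlift_at A.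
Proof.
by have := vlift_at_linear (-1) A 0; rewrite vlift_at0 !addr0 !scaleN1r.
Qed.

Lemma hlift_atZ a (t : T11 M) k x : hlift_at D a t (k *: x) = k *: hlift_at D a t x.
Proof. by have := hlift_at_linear a t k x 0; rewrite hlift_at0 !addr0. Qed.

Lemma hlift_atD a (t : T11 M) x y :
  hlift_at D a t (x + y) = hlift_at D a t x + hlift_at D a t y.
Proof. by have := hlift_at_linear a t 1 x y; rewrite !scale1r. Qed.

Lemma lsubmx_hlift a (t : T11 M) x : lsubmx (hlift_at D a t x) = x.
Proof. by rewrite row_mxKl. Qed.

Lemma rsubmx_hlift a (t : T11 M) x : vec_mx (rsubmx (hlift_at D a t x)) =
  tens t a *m conn_form D a (base t) x - conn_form D a (base t) x *m tens t a.
Proof. by rewrite hlift_atE row_mxKr mxvecK. Qed.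

Lemma lsubmx_vlift A : lsubmx (vlift_at A) = 0.
Proof. by rewrite row_mxKl. Qed.

Lemma rsubmx_vlift A : vec_mx (rsubmx (vlift_at A)) = A.
Proof. by rewrite row_mxKr mxvecK. Qed.

Lemma lift_decomposition a (t : T11 M) (v : 'rV[R]_(n + n * n)) :
  exists A, v = hlift_at D a t (lsubmx v) + vlift_at A.
Proof.
exists (vec_mx (rsubmx v) - vec_mx (rsubmx (hlift_at D a t (lsubmx v)))).
rewrite rsubmx_hlift hlift_atE /vlift_at add_row_mx addr0 -linearD/= addrC subrK.
by rewrite vec_mxK hsubmxK.
Qed.

Section At.
Context (a : cidx M) (pM : proper_chart a) (pT : @proper_chart _ _ _ TM a).
Context (t : T11 M) (at_ : cdom a (base t)).
Let atT : @cdom _ _ _ TM a t := at_.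
Local Notation p := (base t).

Lemma mdiff_vlift (B : mfamily M) : mdiff a (B a) p ->
  @mdiff _ _ _ TM a _ _ (vlift B a) t.
Proof.
move=> dB; apply: (@mdiff_row_mx _ _ _ _ a t (fun=> 0) (fun t => B a (base t))).
  exact: mdiff_cst.
exact: mdiff_base.
Qed.

Lemma dirm_vlift v (B : mfamily M) : mdiff a (B a) p ->
  @dirm _ _ _ TM a v _ _ (vlift B a) t = vlift_at (dirm a (lsubmx v) (B a) p).
Proof.
move=> dB; have := @dirm_row_mx _ _ _ _ a t v (fun=> 0) (fun t => B a (base t)).
by rewrite dirm_cst// dirm_base.
Qed.

Lemma hliftE (X : vfamily M) : hlift D X a = (fun t : T11 M => row_mx (X a (base t))
  (mxvec (tens t a *m conn_form D a (base t) (X a (base t))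
          + - (conn_form D a (base t) (X a (base t)) *m tens t a)))).
Proof. by apply/funext => t'; rewrite /hlift hlift_atE. Qed.

Lemma mdiff_hlift (X : vfamily M) : mdiff a (X a) p ->
  @mdiff _ _ _ TM a _ _ (hlift D X a) t.
Proof.
move=> dX; have dt := mdiff_tens pT at_.
have dw := mdiff_base pM pT at_ (mdiff_conn_form_field D pM at_ dX).
rewrite hliftE; apply: mdiff_row_mx; first exact: mdiff_base.
by apply: mdiffD => //; [|apply: mdiffN => //]; exact: mdiffM.
Qed.

(** The derivative of the components of [X] is lifted horizontally; the vertical
    rest only sees the value of [X] at the base point. *)
Lemma dirm_hlift v (X : vfamily M) : mdiff a (X a) p ->
  let dt := vec_mx (rsubmx v) in
  let w := conn_form D a p (X a p) in
  let dw := dconn_form D a p (lsubmx v) (X a p) in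
  @dirm _ _ _ TM a v _ _ (hlift D X a) t =
  hlift_at D a t (dirm a (lsubmx v) (X a) p)
  + vlift_at (dt *m w - w *m dt + (tens t a *m dw - dw *m tens t a)).
Proof.
move=> dX dt w dw; have dT := mdiff_tens pT at_.
have dW := mdiff_base pM pT at_ (mdiff_conn_form_field D pM at_ dX).
rewrite hliftE dirm_row_mx dirmD//; last 2 first.
- exact: mdiffM.
- by apply: mdiffN => //; exact: mdiffM.
rewrite dirmN//; last exact: mdiffM.
rewrite !dirmM// !dirm_tens// (dirm_base pM pT at_ v dX).
rewrite (dirm_base pM pT at_ v (mdiff_conn_form_field D pM at_ dX)).
rewrite dirm_conn_form// -/dw -/w -/dt.
rewrite hlift_atE /vlift_at add_row_mx addr0 -linearD/=; congr (row_mx _ (mxvec _)).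
rewrite !(mulmxDl, mulmxDr).
mx_module.
Qed.

End At.
End Frame.

(** * The Levi-Civita connection on lifts of constants *)
Section TensorProduct.
Context {R : realType} {T : Type} {n : nat} {M : charts R T n}.
Context (g : metric M) (D : connection M) (hD : levi_civita g D).
Context (a : cidx M) (pM : proper_chart a).
Implicit Types (p : T) (A B C : 'M[R]_n).

(** The metric induced on (1,1)-tensors.  This contraction of the matrix of the
    forms g(A d_j, B d_l) is close to the sums in the curvature terms, while
    [tensor_inner_trace] is the form suited to derivatives. *)
Definition tensor_inner p A B : R :=
  \sum_j \sum_l ginv g a p j l * (A^T *m g a p *m B) j l.

Lemma tensor_inner_sum p A B :
  \sum_i \sum_c \sum_j \sum_l g a p i c * ginv g a p j l * A i j * B c l
  = tensor_inner p A B.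
Proof.
under eq_bigr do rewrite exchange_big/=.
rewrite exchange_big/=; apply: eq_bigr => j _.
under eq_bigr do rewrite exchange_big/=.
rewrite exchange_big/=; apply: eq_bigr => l _.
rewrite mxE mulr_sumr exchange_big/=; apply: eq_bigr => c _.
rewrite mxE mulr_suml mulr_sumr; apply: eq_bigr => i _.
by rewrite mxE; ring.
Qed.

Lemma tensor_inner_trace p A B : cdom a p ->
  tensor_inner p A B = \tr (A^T *m g a p *m B *m ginv g a p).
Proof.
move=> ap; apply: eq_bigr => j _; rewrite [RHS]mxE; apply: eq_bigr => l _.
by rewrite -{1}(ginv_tr g ap) mxE mulrC.
Qed.

Lemma tensor_innerDl p A B C :
  tensor_inner p (A + B) C = tensor_inner p A C + tensor_inner p B C.
Proof.
rewrite -big_split; apply: eq_bigr => j _; rewrite -big_split; apply: eq_bigr => l _.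
by rewrite trmxD !mulmxDl mxE mulrDr.
Qed.

Lemma tensor_innerNl p A C : tensor_inner p (- A) C = - tensor_inner p A C.
Proof.
rewrite -sumrN; apply: eq_bigr => j _; rewrite -sumrN; apply: eq_bigr => l _.
by rewrite trmxN !mulNmx mxE mulrN.
Qed.

Lemma tensor_innerC p A B : cdom a p -> tensor_inner p A B = tensor_inner p B A.
Proof.
move=> ap; rewrite !tensor_inner_trace// -mxtrace_tr !trmx_mul trmxK metric_tr// ginv_tr//.
by rewrite mxtrace_mulC !mulmxA.
Qed.

Lemma diffable_tensor_inner p A B : cdom a p -> diffable a (fun q => tensor_inner q A B) p.
Proof.
move=> ap; apply: diffable_sum => // j; apply: diffable_sum => // l.
apply: diffableM => //; first exact: mdiff_ginv.
have dg := mdiff_metric g ap.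
apply: mdiffM => //; last exact: mdiff_cst.
by apply: mdiffM => //; exact: mdiff_cst.
Qed.

(** The induced metric is parallel: the commutators with the connection form are
    the covariant derivatives of constant tensors. *)
Lemma dirv_tensor_inner p v A B : cdom a p ->
  let w := conn_form D a p v in
  dirv a v (fun q => tensor_inner q A B) p =
  tensor_inner p (w *m A - A *m w) B + tensor_inner p A (w *m B - B *m w).
Proof.
move=> ap w; have dg := mdiff_metric g ap; have dgi := mdiff_ginv g pM ap.
rewrite (dirv_ext _ _ (fun q aq => tensor_inner_trace A B aq)).
have dA := mdiff_cst pM ap A^T; have dB := mdiff_cst pM ap B.
have d1 : mdiff a (fun q => A^T *m g a q) p by exact: mdiffM.
have d2 : mdiff a (fun q => A^T *m g a q *m B) p by exact: mdiffM.
rewrite dirv_trace//; last exact: mdiffM.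
rewrite !dirmM// !dirm_cst// (dirm_metric hD)// (dirm_ginv hD)// -/w.
rewrite mul0mx add0r mulmx0 addr0 !tensor_inner_trace//.
rewrite !(trmxD, trmxN) !trmx_mul.
rewrite !(mulmxDl, mulmxDr, mulNmx, mulmxN) !mulmxA !raddfD/= !raddfN/=.
set G := g a p; set I := ginv g a p.
have E : \tr (A^T *m G *m B *m I *m w^T) = \tr (w^T *m A^T *m G *m B *m I).
  by rewrite mxtrace_mulC !mulmxA.
rewrite E; ring.
Qed.

End TensorProduct.

Section Sasaki.
Context {R : realType} {T : Type} {n : nat} {M : charts R T n}.
Local Notation TM := (T11_charts M).
Context (g : metric M) (D : connection M) (hD : levi_civita g D).
Context (f : T -> R) (S : metric TM) (hS : rescaled_sasaki g D f S).
Context (DS : connection TM) (hDS : levi_civita S DS).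
Context (a : cidx M) (pM : proper_chart a) (pT : @proper_chart _ _ _ TM a).
Context (t : T11 M) (at_ : cdom a (base t)).
Context (hf : diffable a f (base t)) (hf0 : 0 < f (base t)).
Let atT : @cdom _ _ _ TM a t := at_.
Implicit Types (x y z : 'rV[R]_n) (A B C : 'M[R]_n).
Local Notation p := (base t).
Local Notation tt := (tens t a).
Local Notation w := (conn_form D a p).
Local Notation Om := (curv_form D a p).

Definition hconst x : vfamily TM := hlift D (fun _ _ => x).
Definition vconst A : vfamily TM := vlift (fun _ _ => A).

Lemma sasaki_VV (t' : T11 M) : cdom a (base t') -> forall A B,
  bilin (S a t') (vlift_at A) (vlift_at B) = tensor_inner g a (base t') A B.
Proof. by move=> at' A B; have [-> _ _] := hS at' A B 0 0; exact: tensor_inner_sum. Qed.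

Lemma sasaki_VH (t' : T11 M) : cdom a (base t') -> forall A y,
  bilin (S a t') (vlift_at A) (hlift_at D a t' y) = 0.
Proof. by move=> at' A y; have [_ -> _] := hS at' A 0 0 y. Qed.

Lemma sasaki_HV (t' : T11 M) : cdom a (base t') -> forall A y,
  bilin (S a t') (hlift_at D a t' y) (vlift_at A) = 0.
Proof. by move=> at' A y; rewrite metric_bilinC ?sasaki_VH. Qed.

Lemma sasaki_HH (t' : T11 M) : cdom a (base t') -> forall x y,
  bilin (S a t') (hlift_at D a t' x) (hlift_at D a t' y) =
  f (base t') * bilin (g a (base t')) x y.
Proof. by move=> at' x y; have [_ _ ->] := hS at' 0 0 x y. Qed.

Lemma mdiff_hconst x : @mdiff _ _ _ TM a _ _ (hconst x a) t.
Proof. by apply: mdiff_hlift => //; exact: mdiff_cst. Qed.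

Lemma mdiff_vconst A : @mdiff _ _ _ TM a _ _ (vconst A a) t.
Proof. by apply: mdiff_vlift => //; exact: mdiff_cst. Qed.

Lemma dirder_VV (Z : vfamily TM) A B :
  dirder Z (fun t' => bilin (S a t') (vconst A a t') (vconst B a t')) a t =
  dirv a (lsubmx (Z a t)) (fun q => tensor_inner g a q A B) p.
Proof.
rewrite -(dirv_base pM pT at_); last exact: diffable_tensor_inner.
by apply: dirv_ext => t' at'; rewrite sasaki_VV.
Qed.

Lemma dirder_VH (Z : vfamily TM) A y :
  dirder Z (fun t' => bilin (S a t') (vconst A a t') (hconst y a t')) a t = 0.
Proof.
rewrite -(dirv_cst pT atT (Z a t) 0).
by apply: dirv_ext => t' at'; rewrite sasaki_VH.
Qed.

Lemma dirder_HV (Z : vfamily TM) A y :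
  dirder Z (fun t' => bilin (S a t') (hconst y a t') (vconst A a t')) a t = 0.
Proof.
rewrite -(dirv_cst pT atT (Z a t) 0).
by apply: dirv_ext => t' at'; rewrite sasaki_HV.
Qed.

Lemma diffable_bilin x y : diffable a (fun q => bilin (g a q) x y) p.
Proof.
have dg := mdiff_metric g at_.
apply: (diffable_ext (F := fun q => (x *m g a q *m y^T) 0 0)).
  by move=> q _; rewrite bilinE.
apply: mdiffM => //; last exact: mdiff_cst.
by apply: mdiffM => //; exact: mdiff_cst.
Qed.

Lemma dirder_HH (Z : vfamily TM) x y :
  dirder Z (fun t' => bilin (S a t') (hconst x a t') (hconst y a t')) a t =
  dirv a (lsubmx (Z a t)) f p * bilin (g a p) x y
  + f p * dirv a (lsubmx (Z a t)) (fun q => bilin (g a q) x y) p.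
Proof.
have db := diffable_bilin x y.
rewrite -dirvM// -(dirv_base pM pT at_); last exact: diffableM.
by apply: dirv_ext => t' at'; rewrite sasaki_HH.
Qed.

Lemma dirm_hconst v y : @dirm _ _ _ TM a v _ _ (hconst y a) t =
  vlift_at (vec_mx (rsubmx v) *m w y - w y *m vec_mx (rsubmx v)
    + (tt *m dconn_form D a p (lsubmx v) y - dconn_form D a p (lsubmx v) y *m tt)).
Proof.
rewrite dirm_hlift//; last exact: mdiff_cst.
by rewrite dirm_cst// hlift_at0 add0r.
Qed.

Lemma dirm_vconst v A : @dirm _ _ _ TM a v _ _ (vconst A a) t = 0.
Proof.
by rewrite dirm_vlift//; [rewrite dirm_cst// vlift_at0|exact: mdiff_cst].
Qed.

Lemma bracket_HH x y : bracket (hconst x) (hconst y) a t =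
  vlift_at (tt *m Om x y - Om x y *m tt).
Proof.
rewrite bracketE !dirm_hconst !lsubmx_hlift !rsubmx_hlift -vlift_atN -vlift_atD.
congr vlift_at; rewrite /curv_form !(mulmxDl, mulmxDr, mulNmx, mulmxN) !mulmxA.
mx_module.
Qed.

Lemma dconn_form0 y : dconn_form D a p 0 y = 0.
Proof. exact: dirm0. Qed.

Lemma bracket_HV x A : bracket (hconst x) (vconst A) a t =
  vlift_at (w x *m A - A *m w x).
Proof.
rewrite bracketE dirm_vconst dirm_hconst lsubmx_vlift rsubmx_vlift dconn_form0.
by rewrite mulmx0 mul0mx subr0 addr0 sub0r -vlift_atN opprB.
Qed.

Lemma bracketC (X Y : vfamily TM) : bracket Y X a t = - bracket X Y a t.
Proof. by rewrite !bracketE opprB. Qed.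

Lemma bracket_VV A B : bracket (vconst A) (vconst B) a t = 0.
Proof. by rewrite bracketE !dirm_vconst subr0. Qed.

(** Horizontal vectors are the orthogonal complement of the vertical ones. *)
Lemma bilin_vlift_eq0 (v : 'rV[R]_(n + n * n)) :
  (forall A, bilin (S a t) v (vlift_at A) = 0) -> v = hlift_at D a t (lsubmx v).
Proof.
have [A E] := lift_decomposition D a t v => H.
have vA0 : vlift_at A = 0.
  apply/eqP; apply: contraT => /(gcomp_posdef S atT).
  by have := H A; rewrite {1}E bilinDl sasaki_HV// add0r => ->; rewrite ltxx.
by rewrite {1}E vA0 addr0.
Qed.

Lemma bilin_hlift (v : 'rV[R]_(n + n * n)) x :
  bilin (S a t) v (hlift_at D a t x) = f p * bilin (g a p) (lsubmx v) x.
Proof.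
have [A {1}->] := lift_decomposition D a t v.
by rewrite bilinDl sasaki_VH// addr0 sasaki_HH.
Qed.

Lemma two_neq0 : (2 : R) != 0. Proof. by rewrite pnatr_eq0. Qed.

(** The product with a vertical vector vanishes because vertical derivatives of
    the metric and vertical brackets do; in the product with a horizontal one,
    the two brackets compensate the derivative of the induced metric. *)
Lemma nabla_VV A B : nabla DS (vconst A) (vconst B) a t = 0.
Proof.
have dv := mdiff_vconst; have dh := mdiff_hconst.
have l0 : forall x, bilin (g a p) (lsubmx (nabla DS (vconst A) (vconst B) a t)) x = 0.
  move=> x; apply: (mulfI (lt0r_neq0 hf0)); rewrite mulr0 -bilin_hlift.
  apply: (mulfI two_neq0); rewrite mulr0.
  rewrite (koszul hDS pT atT (dv A) (dv B) (dh x)).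
  rewrite !dirder_VH dirder_VV bracket_VV (bracketC (hconst x)) bracket_HV.
  rewrite (bracketC (hconst x)) bracket_HV lsubmx_hlift (dirv_tensor_inner hD)//.
  rewrite bilin0l !bilinNl !sasaki_VV//.
  rewrite (tensor_innerC g _ A)//; ring.
rewrite (bilin_vlift_eq0 (v := nabla _ _ _ _ _)); last first.
  move=> C; apply: (mulfI two_neq0); rewrite mulr0.
  rewrite (koszul hDS pT atT (dv A) (dv B) (dv C)).
  rewrite !dirder_VV !bracket_VV !bilin0l !lsubmx_vlift !dirv0; ring.
by rewrite (metric_nondegenerate at_ l0) hlift_at0.
Qed.

(** All terms of the Koszul formula vanish or cancel, except for the curvature
    part of the bracket of two horizontal lifts. *)
Lemma nabla_VH C y : exists k,
  nabla DS (vconst C) (hconst y) a t = hlift_at D a t k /\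
  forall x, 2 * f p * bilin (g a p) k x =
    tensor_inner g a p (tt *m Om x y - Om x y *m tt) C.
Proof.
have dv := mdiff_vconst; have dh := mdiff_hconst.
exists (lsubmx (nabla DS (vconst C) (hconst y) a t)); split.
  apply: bilin_vlift_eq0 => A; apply: (mulfI two_neq0); rewrite mulr0.
  rewrite (koszul hDS pT atT (dv C) (dh y) (dv A)).
  rewrite dirder_HV dirder_VV dirder_VH bracket_VV (bracketC (hconst y) (vconst C)).
  rewrite !bracket_HV lsubmx_hlift (dirv_tensor_inner hD)//.
  rewrite bilin0l bilinNl !sasaki_VV// (tensor_innerC g _ C)//; ring.
move=> x; rewrite -mulrA -bilin_hlift (koszul hDS pT atT (dv C) (dh y) (dh x)).
rewrite !dirder_VH dirder_HH lsubmx_vlift !dirv0.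
rewrite (bracketC (hconst y) (vconst C)) (bracketC (hconst x) (vconst C)).
rewrite (bracketC (hconst x) (hconst y)) bracket_HH !bracket_HV !bilinNl.
rewrite !sasaki_VH// sasaki_VV//; ring.
Qed.

Lemma nabla_HV x A : nabla DS (hconst x) (vconst A) a t =
  nabla DS (vconst A) (hconst x) a t + vlift_at (w x *m A - A *m w x).
Proof. by rewrite (torsion_free hDS atT) bracket_HV. Qed.

(** The Koszul formula for [f] times [g] is [f] times that for [g], plus the
    terms in which [f] is differentiated. *)
Lemma nabla_HH x y : exists A,
  nabla DS (hconst x) (hconst y) a t =
    hlift_at D a t (y *m (w x)^T
       + (2 * f p)^-1 *: fA g f (fun _ _ => x) (fun _ _ => y) a p)
    + vlift_at A.
Proof.
have dv := mdiff_vconst; have dh := mdiff_hconst.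
have [A E] := lift_decomposition D a t (nabla DS (hconst x) (hconst y) a t).
exists A; rewrite {1}E; congr (hlift_at _ _ _ _ + _).
apply/eqP; rewrite -subr_eq0; apply/eqP; apply: (metric_nondegenerate (g := g) at_) => z.
rewrite bilinDl bilinNl; apply/eqP; rewrite subr_eq0; apply/eqP.
have f2 : 2 * f p != 0 by rewrite mulf_neq0 ?two_neq0// gt_eqF.
apply: (mulfI f2); rewrite -mulrA -bilin_hlift.
rewrite (koszul hDS pT atT (dh x) (dh y) (dh z)) !dirder_HH !bracket_HH !sasaki_VH//.
rewrite !lsubmx_hlift bilinDl bilinZl mulrDr mulrA mulfV// mul1r.
have cst x' := mdiff_cst pM at_ x'.
(* The same formula on the base, for the constant fields [x], [y], [z]. *)
have K := @koszul _ _ _ _ g D hD a p pM at_ (fun _ _ => x) (fun _ _ => y) (fun _ _ => z)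
   (cst x) (cst y) (cst z).
rewrite nablaE !bracketE !dirm_cst// subr0 !bilin0l add0r !subr0 addr0 in K.
rewrite mulrAC K /fA bilinDl bilinDl bilinNl !bilinZl.
have -> : bilin (g a p) (grad g f a p) z = dirv a z f p.
  rewrite (_ : grad g f a p = (\row_k pd a k f p) *m (ginv g a p)^T).
    rewrite bilinE -(mulmxA _ _ (g a p)) ginv_tr// mulVmx ?metric_unit// mulmx1.
    by rewrite mxE; apply: eq_bigr => k _; rewrite !mxE mulrC.
  by apply/rowP => k; rewrite !mxE; apply: eq_bigr => l _; rewrite !mxE mulrC.
rewrite /dirder -!/(dirv _ _ _ _); ring.
Qed.

End Sasaki.

(** * The curvature terms *)
Section CurvatureTerms.
Context {R : realType} {T : Type} {n : nat} {M : charts R T n}.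
Local Notation TM := (T11_charts M).
Context (g : metric M) (D : connection M) (hD : levi_civita g D).
Context (a : cidx M) (pM : proper_chart a).
Context (t : T11 M) (at_ : cdom a (base t)).
Context (C : mfamily M) (Y : vfamily M).
Local Notation p := (base t).
Local Notation tt := (tens t a).
Local Notation Om := (curv_form D a p).

Lemma curv_form_entry x y r m :
  Om x y r m = \sum_k \sum_l x 0 k * y 0 l * Rcomp D a p k l m r.
Proof.
rewrite {1}(row_sum_delta x) {1}(row_sum_delta y) curv_form_suml// summxE.
apply: eq_bigr => k _; rewrite mxE curv_form_sumr// summxE mulr_sumr.
by apply: eq_bigr => l _; rewrite mxE curv_form_Rcomp// mulrA.
Qed.

Lemma curv_form_entry_delta k y r m :
  Om (delta_mx 0 k) y r m = \sum_l y 0 l * Rcomp D a p k l m r.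
Proof.
rewrite curv_form_entry (bigD1 k)//= [X in _ + X]big1 ?addr0; last first.
  by move=> k' kk'; rewrite big1// => l _; rewrite mxE (negbTE kk') !mul0r.
by apply: eq_bigr => l _; rewrite mxE !eqxx mul1r.
Qed.

(** The vector [curv_term2] is a covector [beta] with its index raised, so that
    its product with [x] is [beta] evaluated at [x]. *)
Lemma bilin_curv_term2 x :
  bilin (g a p) (curv_term2 g D C Y a t) x =
  tensor_inner g a p (tt *m Om x (Y a p)) (C a p).
Proof.
pose beta : 'rV[R]_n :=
  \row_k tensor_inner g a p (tt *m Om (delta_mx 0 k) (Y a p)) (C a p).
have -> : curv_term2 g D C Y a t = beta *m ginv g a p.
  apply/rowP => r; rewrite !mxE.
  under eq_bigr => e _.
    under eq_bigr => c _ do rewrite exchange_big/=.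
    rewrite exchange_big/=.
    over.
  rewrite exchange_big/=; apply: eq_bigr => k _.
  rewrite [RHS]mulrC mxE -tensor_inner_sum mulr_sumr; apply: eq_bigr => e _.
  rewrite mulr_sumr; apply: eq_bigr => c _.
  under eq_bigr => s _ do rewrite exchange_big/=.
  rewrite exchange_big/= mulr_sumr; apply: eq_bigr => b _.
  under eq_bigr => s _ do rewrite exchange_big/=.
  rewrite exchange_big/= mulr_sumr; apply: eq_bigr => l _.
  rewrite mxE mulr_sumr mulr_suml mulr_sumr; apply: eq_bigr => s _.
  rewrite curv_form_entry_delta !(mulr_sumr, mulr_suml).
  by apply: eq_bigr => m _; ring.
rewrite bilinE -(mulmxA _ _ (g a p)) mulVmx ?metric_unit// mulmx1 mxE.
rewrite [x in RHS]row_sum_delta curv_form_suml// mulmx_sumr.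
have tensor_inner0 B : tensor_inner g a p 0 B = 0.
  rewrite /tensor_inner big1// => j _; rewrite big1// => l _.
  by rewrite trmx0 !mul0mx mxE mulr0.
have tensor_innerZ c A B : tensor_inner g a p (c *: A) B = c * tensor_inner g a p A B.
  rewrite mulr_sumr; apply: eq_bigr => j _; rewrite mulr_sumr.
  by apply: eq_bigr => l _; rewrite linearZ/= -!scalemxAl mxE mulrCA.
rewrite (big_morph (fun A => tensor_inner g a p A (C a p))
  (fun A B => tensor_innerDl g a p A B _) (tensor_inner0 _)).
by apply: eq_bigr => k _; rewrite -scalemxAr tensor_innerZ !mxE mulrC.
Qed.

(** The symmetry by pairs brings the direction [x] into the first pair of
    arguments of the curvature. *)
Lemma bilin_curv_term1 x :
  bilin (g a p) (curv_term1 g D C Y a t) x =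
  - tensor_inner g a p (Om x (Y a p) *m tt) (C a p).
Proof.
(* The vectors t_b and C_l of the contraction. *)
pose tb b : 'rV[R]_n := (col b tt)^T.
pose cl l : 'rV[R]_n := (col l (C a p))^T.
have -> : curv_term1 g D C Y a t =
    \sum_b \sum_l ginv g a p b l *: (Y a p *m (Om (tb b) (cl l))^T).
  apply/rowP => r; rewrite mxE summxE; apply: eq_bigr => b _.
  rewrite summxE; apply: eq_bigr => l _; rewrite !mxE.
  under [in RHS]eq_bigr => m _ do rewrite mxE curv_form_entry mulr_sumr.
  rewrite [in RHS]exchange_big/= mulr_sumr; apply: eq_bigr => s _.
  under [in RHS]eq_bigr => m _ do rewrite mulr_sumr.
  rewrite [in RHS]exchange_big/= mulr_sumr; apply: eq_bigr => i _.
  rewrite mulr_sumr; apply: eq_bigr => m _.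
  by rewrite !mxE; ring.
have bsum (I : Type) (r : seq I) (F : I -> 'rV[R]_n) :
    bilin (g a p) (\sum_(i <- r) F i) x = \sum_(i <- r) bilin (g a p) (F i) x.
  exact: (big_morph (fun v => bilin (g a p) v x)
    (fun v w => bilinDl _ v w x) (bilin0l _ x)).
rewrite bsum -sumrN; apply: eq_bigr => b _.
rewrite bsum -sumrN; apply: eq_bigr => l _.
rewrite bilinZl -mulrN; congr (_ * _).
rewrite -[LHS]/(riem g D a p _ _ _ _) (riem_pair hD)// /riem.
rewrite curv_formN trmxN mulmxN bilinNl bilinE; congr (- _).
rewrite /tb /cl tr_col -!row_mul trmxK trmx_mul [LHS]mxE [LHS]mxE [RHS]mxE.
by apply: eq_bigr => i _; rewrite [col _ _ _ _]mxE.
Qed.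

End CurvatureTerms.

(** * Almost product structures and the deformed connection *)
Section EigenFamilies.
Context {R : realType} {T : Type} {m : nat} {N : charts R T m}.
Context (D : connection N) (J : tensor11_field N).
Context (a : cidx N) (p : T) (pa : proper_chart a) (ap : cdom a p).
Implicit Types (X Y Z : vfamily N).

Lemma app11E (A : 'M[R]_m) v : app11 A v = v *m A^T.
Proof. by apply/rowP => i; rewrite !mxE; apply: eq_bigr => j _; rewrite mxE mulrC. Qed.

Lemma nabla_eigen e X Y : mdiff a (Y a) p ->
  (forall q, cdom a q -> appf J Y a q = e *: Y a q) ->
  nabla D X (appf J Y) a p = e *: nabla D X Y a p.
Proof.
move=> dY JY; rewrite !nablaE JY// (dirm_ext _ _ JY).
have -> : dirm a (X a p) (fun q => e *: Y a q) p =
    dirm a (X a p) (fun q => e%:M *m Y a q) p.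
  by apply: dirm_ext => q _; rewrite mul_scalar_mx.
rewrite dirmM//; last exact: mdiff_cst.
by rewrite dirm_cst// mul0mx add0r mul_scalar_mx -scalemxAl scalerDr.
Qed.

Lemma nabla_dirZ e X X' Y : X' a p = e *: X a p ->
  nabla D X' Y a p = e *: nabla D X Y a p.
Proof.
move=> XX'; rewrite !nablaE XX' scalerDr; congr (_ + _).
  by have := dirm_linear a (Y a) p e (X a p) 0; rewrite dirm0 !addr0.
have -> : conn_form D a p (e *: X a p) = e *: conn_form D a p (X a p).
  apply/matrixP => h j; rewrite !mxE mulr_sumr; apply: eq_bigr => i _.
  by rewrite mxE; ring.
by rewrite linearZ/= -scalemxAr.
Qed.

(** On a family where [J] is a scalar it commutes with the connection, so only
    the values of [J] on the two covariant derivatives remain. *)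
Lemma nablaP_eigen e e' X Y : mdiff a (X a) p -> mdiff a (Y a) p ->
  (forall v, app11 (J a p) (app11 (J a p) v) = v) ->
  (forall q, cdom a q -> appf J X a q = e *: X a q) ->
  (forall q, cdom a q -> appf J Y a q = e' *: Y a q) ->
  let P := nabla D Y X a p in let Q := nabla D X Y a p in
  let j := app11 (J a p) in
  nablaP D J X Y a p =
    Q - 2^-1 *: (e' *: (e *: P - j P) + (e *: j P - P) - (e' *: j Q - Q)).
Proof.
move=> dX dY JJ JX JY P Q j.
have nJ c Z W : mdiff a (W a) p -> (forall q, cdom a q -> appf J W a q = c *: W a q) ->
    nablaJ D J Z W a p = c *: nabla D Z W a p - j (nabla D Z W a p).
  by move=> dW JW; rewrite /nablaJ (nabla_eigen _ dW JW).
rewrite /nablaP /Stensor.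
rewrite -[appf J (nablaJ D J Y X) a p]/(j (nablaJ D J Y X a p)).
rewrite -[appf J (nablaJ D J X Y) a p]/(j (nablaJ D J X Y a p)).
rewrite !(nJ _ _ _ dX JX) (nJ _ _ _ dY JY) -/P -/Q.
rewrite (nabla_dirZ X (JY p ap)) -/P.
have jZ k v : j (k *: v) = k *: j v by rewrite /j !app11E -scalemxAl.
have jB v w : j (v - w) = j v - j w by rewrite /j !app11E mulmxBl.
have jj v : j (j v) = v by exact: JJ.
congr (_ - _ *: _); rewrite !jB !jZ !jj.
by rewrite [in RHS]scalerBr !scalerA (mulrC e).
Qed.

End EigenFamilies.

Section ProductStructure.
Context {R : realType} {T : Type} {n : nat} {M : charts R T n}.
Local Notation TM := (T11_charts M).
Context (g : metric M) (D : connection M) (hD : levi_civita g D).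
Context (f : T -> R) (S : metric TM) (hS : rescaled_sasaki g D f S).
Context (J : tensor11_field TM) (hJ : product_structure D J).
Context (DS : connection TM) (hDS : levi_civita S DS).
Context (a : cidx M) (pM : proper_chart a) (pT : @proper_chart _ _ _ TM a).
Context (t : T11 M) (at_ : cdom a (base t)).
Context (hf : diffable a f (base t)) (hf0 : 0 < f (base t)).
Let atT : @cdom _ _ _ TM a t := at_.
Local Notation p := (base t).
Local Notation j := (app11 (J a t)).

Lemma J_hlift x : j (hlift_at D a t x) = - hlift_at D a t x.
Proof. by have [] := hJ at_ 0 x. Qed.

Lemma J_vlift A : j (vlift_at A) = vlift_at A.
Proof. by have [] := hJ at_ A 0. Qed.

Lemma app11D (A : 'M[R]_(n + n * n)) u v : app11 A (u + v) = app11 A u + app11 A v.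
Proof. by rewrite !app11E mulmxDl. Qed.

Lemma J_involutive v : j (j v) = v.
Proof.
have [A ->] : exists A, v = hlift_at D a t (lsubmx v) + vlift_at A.
  exact: lift_decomposition.
rewrite !app11D J_hlift !J_vlift; congr (_ + _).
by rewrite app11E mulNmx -app11E J_hlift opprK.
Qed.

Lemma nabla_hlift_const (Z : vfamily TM) (Y : vfamily M) : mdiff a (Y a) p ->
  nabla DS Z (hlift D Y) a t = hlift_at D a t (dirm a (lsubmx (Z a t)) (Y a) p)
    + nabla DS Z (hconst D (Y a p)) a t.
Proof. by move=> dY; rewrite !nablaE dirm_hlift// (dirm_hconst D pM pT at_) -[LHS]addrA. Qed.

Lemma nabla_vlift_const (Z : vfamily TM) (B : mfamily M) : mdiff a (B a) p ->
  nabla DS Z (vlift B) a t = vlift_at (dirm a (lsubmx (Z a t)) (B a) p)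
    + nabla DS Z (vconst (B a p)) a t.
Proof. by move=> dB; rewrite !nablaE dirm_vlift// (dirm_vconst pM pT at_) add0r. Qed.

Lemma nabla_dir (Z Z' Y : vfamily TM) : Z a t = Z' a t ->
  nabla DS Z Y a t = nabla DS Z' Y a t.
Proof. by move=> ZZ'; rewrite !nablaE ZZ'. Qed.

Context (X Y : vfamily M) (B C : mfamily M).
Context (dX : mdiff a (X a) p) (dY : mdiff a (Y a) p).
Context (dB : mdiff a (B a) p) (dC : mdiff a (C a) p).

(** The vertical part of this derivative is killed by the deformation, and is
    left unspecified. *)
Lemma nabla_hlift_hlift : exists A,
  nabla DS (hlift D X) (hlift D Y) a t =
    hlift_at D a t (nabla D X Y a p + (2 * f p)^-1 *: fA g f X Y a p) + vlift_at A.
Proof.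
have [A E] := nabla_HH hD hS hDS pM pT at_ hf hf0 (X a p) (Y a p).
exists A; rewrite nabla_hlift_const// (nabla_dir (Z' := hconst D (X a p)))// E.
by rewrite lsubmx_hlift nablaE addrA -hlift_atD addrA.
Qed.

Lemma nabla_vlift_hlift :
  nabla DS (vlift C) (hlift D Y) a t =
    (2 * f p)^-1 *: hlift_at D a t (curv_term1 g D C Y a t + curv_term2 g D C Y a t).
Proof.
rewrite nabla_hlift_const// lsubmx_vlift dirm0 hlift_at0 add0r.
rewrite (nabla_dir (Z' := vconst (C a p)))//.
have [k [-> H]] := nabla_VH hD hS hDS pM pT at_ hf (C a p) (Y a p).
rewrite -hlift_atZ; congr hlift_at; apply/eqP; rewrite -subr_eq0; apply/eqP.
apply: (metric_nondegenerate (g := g) at_) => x.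
have f2 : 2 * f p != 0 by rewrite mulf_neq0 ?two_neq0// gt_eqF.
rewrite bilinDl bilinNl bilinZl; apply: (mulfI f2).
rewrite mulrDr H mulr0 mulrN mulrA mulfV// mul1r bilinDl.
rewrite (bilin_curv_term1 hD pM at_) (bilin_curv_term2 g D pM at_).
by rewrite tensor_innerDl tensor_innerNl; ring.
Qed.

Lemma nabla_vlift_vlift : nabla DS (vlift C) (vlift B) a t = 0.
Proof.
rewrite nabla_vlift_const// lsubmx_vlift dirm0 vlift_at0 add0r.
by rewrite (nabla_dir (Z' := vconst (C a p)))// (nabla_VV hD hS hDS).
Qed.

Lemma nabla_hlift_vlift :
  nabla DS (hlift D X) (vlift B) a t =
    vlift_at (nabla11 D X B a p) + nabla DS (vlift B) (hlift D X) a t.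
Proof.
rewrite nabla_vlift_const// lsubmx_hlift.
rewrite (nabla_dir (Z' := hconst D (X a p)))// (nabla_HV D hDS pM pT at_).
rewrite nabla_hlift_const// lsubmx_vlift dirm0 hlift_at0 add0r.
rewrite [in RHS](nabla_dir (Z' := vconst (B a p)))// nabla11E vlift_atD.
by rewrite -[RHS]addrA; congr (_ + _); rewrite addrC.
Qed.

End ProductStructure.

(** * The deformed connection on lifts *)
Theorem theorem4 (R : realType) (n : nat) (T : topologicalType)
    (M : charts R T n) (hM : smooth_manifold M)
    (g : metric M) (D : connection M) (hD : levi_civita g D)
    (f : T -> R) (hf : smooth_fun M f) (hf0 : forall p, 0 < f p)
    (S : metric (T11_charts M)) (hS : rescaled_sasaki g D f S)
    (J : tensor11_field (T11_charts M)) (hJ : product_structure D J)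
    (DS : connection (T11_charts M)) (hDS : levi_civita S DS)
    (X Y : vector_field M) (B C : tensor11_field M) :
  [/\ same_family (nablaP DS J (hlift D X) (hlift D Y))
        (hlift D (fun a p =>
           nabla D X Y a p + (2 * f p)^-1 *: fA g f X Y a p)),
      same_family (nablaP DS J (hlift D X) (vlift B))
        (vlift (nabla11 D X B)),
      same_family (nablaP DS J (vlift C) (hlift D Y))
        (fun a t => (3 / (2 * f (base t))) *:
           hlift_at D a t (curv_term1 g D C Y a t + curv_term2 g D C Y a t)) &
      same_family (nablaP DS J (vlift C) (vlift B)) (fun _ _ => 0)].
Proof.
have pM (a : cidx M) : proper_chart a.
  apply: (metric_proper_chart g) => p q; rewrite !inE => ap aq.
  exact: (man_coord_inj hM).
have pT (a : cidx M) : @proper_chart _ _ _ (T11_charts M) a.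
  by apply: (metric_proper_chart S); apply: T11_coord_inj; case: (pM a).
have dv (Z : vector_field M) a p : cdom a p -> mdiff a (Z a) p.
  by move=> ap i j; rewrite ord1; exact: (@vcomp_smooth _ _ _ _ Z a j [::]).
have dt (A : tensor11_field M) a p : cdom a p -> mdiff a (A a) p.
  by move=> ap i j; exact: (@tcomp_smooth _ _ _ _ A a i j [::]).
have JH (Z : vector_field M) a (t : T11 M) : @cdom _ _ _ (T11_charts M) a t ->
    appf J (hlift D Z) a t = (-1) *: hlift D Z a t.
  by move=> at_; rewrite scaleN1r; exact: J_hlift.
have JV (A : tensor11_field M) a (t : T11 M) : @cdom _ _ _ (T11_charts M) a t ->
    appf J (vlift A) a t = 1 *: vlift A a t.
  by move=> at_; rewrite scale1r; exact: (J_vlift hJ).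
have dH (Z : vector_field M) a (t : T11 M) : cdom a (base t) ->
    @mdiff _ _ _ (T11_charts M) a _ _ (hlift D Z a) t.
  by move=> at_; apply: mdiff_hlift => //; exact: dv.
have dV (A : tensor11_field M) a (t : T11 M) : cdom a (base t) ->
    @mdiff _ _ _ (T11_charts M) a _ _ (vlift A a) t.
  by move=> at_; apply: mdiff_vlift => //; exact: dt.
split=> a t atT; have at_ : @cdom _ _ _ M a (base t) := atT;
  have df := hf a [::] _ at_;
  have JJ := J_involutive hJ at_.
- rewrite (nablaP_eigen DS (pT a) atT (dH X a t at_) (dH Y a t at_) JJ (JH X a) (JH Y a)).
  have [A ->] := nabla_hlift_hlift hD hS hDS (pM a) (pT a) at_ df (hf0 _)
     X (dv Y a _ at_).
  rewrite app11D (J_hlift hJ at_) (J_vlift hJ at_) /hlift.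
  move: (nabla DS _ _ _ _) => P; move: (app11 _ P) => jP.
  move: (hlift_at D a t _) (vlift_at A) => h v.
  by apply/rowP => i; rewrite !mxE; field.
- rewrite (nablaP_eigen DS (pT a) atT (dH X a t at_) (dV B a t at_) JJ (JH X a) (JV B a)).
  rewrite (nabla_hlift_vlift D hDS (pM a) (pT a) at_ (dv X a _ at_) (dt B a _ at_)).
  rewrite (nabla_vlift_hlift hD hS hDS (pM a) (pT a) at_ df (hf0 _) B (dv X a _ at_)).
  rewrite -hlift_atZ app11D (J_hlift hJ at_) (J_vlift hJ at_) [RHS]/vlift.
  move: (hlift_at D a t _) (vlift_at _) => h v.
  by apply/rowP => i; rewrite !mxE; field.
- rewrite (nablaP_eigen DS (pT a) atT (dV C a t at_) (dH Y a t at_) JJ (JV C a) (JH Y a)).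
  rewrite (nabla_hlift_vlift D hDS (pM a) (pT a) at_ (dv Y a _ at_) (dt C a _ at_)).
  rewrite (nabla_vlift_hlift hD hS hDS (pM a) (pT a) at_ df (hf0 _) C (dv Y a _ at_)).
  rewrite -[RHS]scalerA -!(hlift_atZ D _ _ (2 * f (base t))^-1).
  rewrite app11D (J_hlift hJ at_) (J_vlift hJ at_).
  move: (hlift_at D a t _) (vlift_at _) => h v.
  by apply/rowP => i; rewrite !mxE; field.
- rewrite (nablaP_eigen DS (pT a) atT (dV C a t at_) (dV B a t at_) JJ (JV C a) (JV B a)).
  rewrite (nabla_vlift_vlift hD hS hDS (pM a) (pT a) at_ (hf0 _) B (dt C a _ at_)).
  rewrite (nabla_vlift_vlift hD hS hDS (pM a) (pT a) at_ (hf0 _) C (dt B a _ at_)).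
  rewrite app11E mul0mx.
  by rewrite !(subrr, subr0, scaler0, addr0).
Qed.
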